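(* Let $\theta$ be a real number with $|\theta|<\pi$. Then the following four identities hold: \[ \pi^2\sum_{n=1}^\infty \frac{(-1)^n\cosh(n\theta)}{\sinh^2(\pi n)} + \theta\pi\sum_{n=1}^\infty \frac{\sin(n\theta)}{\sinh(\pi n)} + \pi^2\sum_{n=1}^\infty \frac{\cos(n\theta)\cosh(\pi n)}{\sinh^2(\pi n)} + \frac{\theta^2}{4} - \frac12\zeta(2) = 0, \] \[ \pi^2\sum_{n=1}^\infty \frac{(-1)^n\sinh\left(\frac{2n-1}{2}\theta\right)}{\cosh^2\left(\frac{2n-1}{2}\pi\right)} - \theta\pi\sum_{n=1}^\infty \frac{\cos\left(\frac{2n-1}{2}\theta\right)}{\cosh\left(\frac{2n-1}{2}\pi\right)} + \pi^2\sum_{n=1}^\infty \frac{\sin\left(\frac{2n-1}{2}\theta\right)\sinh\left(\frac{2n-1}{2}\pi\right)}{\cosh^2\left(\frac{2n-1}{2}\pi\right)} = 0, \] \[ \pi^2\sum_{n=1}^\infty \frac{(-1)^n\cosh(n\theta)}{\cosh^2(\pi n)} - \theta\pi\sum_{n=1}^\infty \frac{\sin\left(\frac{2n-1}{2}\theta\right)}{\sinh\left(\frac{2n-1}{2}\pi\right)} - \pi^2\sum_{n=1}^\infty \frac{\cos\left(\frac{2n-1}{2}\theta\right)\cosh\left(\frac{2n-1}{2}\pi\right)}{\sinh^2\left(\frac{2n-1}{2}\pi\right)} + \frac{\pi^2}{2} = 0, \] \[ \pi^2\sum_{n=1}^\infty \frac{(-1)^n\sinh\left(\frac{2n-1}{2}\theta\right)}{\sinh^2\left(\frac{2n-1}{2}\pi\right)}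 + \theta\pi\sum_{n=1}^\infty \frac{\cos(n\theta)}{\cosh(\pi n)} - \pi^2\sum_{n=1}^\infty \frac{\sin(n\theta)\sinh(\pi n)}{\cosh^2(\pi n)} + \frac{\pi\theta}{2} = 0. \]
   Context: $\zeta(s)=\sum_{n\ge1}n^{-s}$ is the Riemann zeta function; in particular $\zeta(2)=\pi^2/6$. *)

(* Defs.v *)
From Stdlib Require Export Reals.
From Coquelicot Require Export Coquelicot.

Open Scope R_scope.

(* [sum_from_1 a l]: the series a 1 + a 2 + a 3 + ... converges to l;
   Coquelicot's [is_series] starts at index 0, hence the shift. *)
Definition sum_from_1 (a : nat -> R) (l : R) : Prop :=
  is_series (fun k : nat => a (S k)) l.

(* Meaningful for real s > 1 only: [Series] has a default value when the
   series diverges. *)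
Definition zeta (s : R) : R :=
  Series (fun k : nat => Rpower (INR (S k)) (- s)).

Definition half_odd (n : nat) : R := (2 * INR n - 1) / 2.

(* Main.v *)
Require Import Defs.
From Stdlib Require Import ZArith Lra Lia.

(** Fix [theta >= 0] and write [beta] for the period, in units of [2 PI].  The function
    [sum_n (-1)^n exp (- nu_n theta) / nu_n] (a logarithm for [nu_n = n + 1], an arctangent
    for [nu_n = n + 1/2]), made periodic or antiperiodic of half-period [beta PI] by adding
    its images, changes by [+- sum_n (-1)^n w (nu_n beta PI) g (nu_n theta) / nu_n], where
    [g] and [h] are [cosh] or [sinh], [w t = exp (- t) / h t] and [w' = - 1 / h^2].  Up to
    an explicit polynomial, the Fourier coefficients of the result on [0, beta PI] are
    [- 1 / (kappa k (PI kappa / beta))] with [k] = [sinh] or [cosh], by the partial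
    fraction expansions of [1 / sinh] and [1 / cosh].  In the resulting identity the original function does not depend on [beta]; differentiating with respect
    to [beta] at [beta = 1] gives the four formulas, one for each choice of integer or
    half-integer frequencies [nu] and [kappa].

    Both the Fourier expansions and the partial fractions rest on the completeness of the
    four trigonometric systems on [0, PI], proved with the peaking kernels
    [(1 + d - (cos x - cos x0)^2 / 4)^n]. *)

(** * Completeness of the cosines *)

(** The squared denominators of the theorem come from [w' = - 1 / h^2] on the image side and
    [(1 / k)' = - k' / k^2] on the Fourier side; in both, the chain rule cancels the factor [1 / nu]
    or [1 / kappa]. Since [theta < PI] strictly, [theta <= beta * PI] persists for [beta] near [1],
    so the expansion may be differentiated there with [theta] fixed. The obstacle is that the
    original sum converges only conditionally at [theta = 0], so termwise integration cannot rest on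
    absolute convergence. The alternating series bound gives an error uniform in [theta >= 0], and
    the expansion theorem is therefore stated for uniform limits. For [theta < 0] the sum diverges;
    parity recovers that range at the end. Cosines go with [nu = n + 1] and sines with
    [nu = n + 1/2]: with [a = nu * beta], the coefficients of the kernels are [a / (a^2 + kappa^2)]
    and [kappa / (a^2 + kappa^2)], and after division by [nu] their alternating sums over [n] are
    the expansions of [1 / sinh] and [1 / cosh]. The choice of [kappa] is free and decides between
    periodic and antiperiodic images. *)

Lemma is_RInt_eq_ext (f g : R -> R) (a b l : R) :
  (forall x, f x = g x) -> is_RInt f a b l -> is_RInt g a b l.
Proof. intros E; apply is_RInt_ext; intros; apply E. Qed.

Lemma is_RInt_lincomb (f g : R -> R) (a b c d If Ig : R) :
  is_RInt f a b If -> is_RInt g a b Ig ->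
  is_RInt (fun x => c * f x + d * g x) a b (c * If + d * Ig).
Proof.
  intros Hf Hg.
  exact (is_RInt_plus _ _ _ _ _ _ (is_RInt_scal _ _ _ c _ Hf) (is_RInt_scal _ _ _ d _ Hg)).
Qed.

Lemma continuous_lincomb (f g : R -> R) (c d x : R) :
  continuous f x -> continuous g x -> continuous (fun y => c * f y + d * g y) x.
Proof.
  intros Hf Hg.
  exact (continuous_plus _ _ _ (continuous_scal_r c f x Hf) (continuous_scal_r d g x Hg)).
Qed.

Lemma continuous_Rmult (f g : R -> R) (x : R) :
  continuous f x -> continuous g x -> continuous (fun y => f y * g y) x.
Proof. intros Hf Hg; exact (continuous_mult f g x Hf Hg). Qed.

(* [k] ranges over [Z] so that the family is stable under multiplication by [cos]. *)
Definition cos_orthogonal (f : R -> R) : Prop :=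
  (forall x, continuous f x) /\
  forall k : Z, is_RInt (fun x => f x * cos (IZR k * x)) 0 PI 0.

Lemma cos_orthogonal_ext (f g : R -> R) :
  (forall x, f x = g x) -> cos_orthogonal f -> cos_orthogonal g.
Proof.
  intros E [Hc Ho]; split.
  - intros x; apply continuous_ext with f; auto.
  - intros k; apply is_RInt_eq_ext with (2 := Ho k).
    intros x; now rewrite E.
Qed.

Lemma cos_orthogonal_lincomb (f g : R -> R) (c d : R) :
  cos_orthogonal f -> cos_orthogonal g ->
  cos_orthogonal (fun x => c * f x + d * g x).
Proof.
  intros [Cf Of] [Cg Og]; split.
  - intros x; now apply continuous_lincomb.
  - intros k; generalize (is_RInt_lincomb _ _ _ _ c d _ _ (Of k) (Og k)).
    replace (c * 0 + d * 0) with 0 by ring.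
    apply is_RInt_eq_ext; intros x; ring.
Qed.

Lemma cos_orthogonal_mul_cos (f : R -> R) :
  cos_orthogonal f -> cos_orthogonal (fun x => f x * cos x).
Proof.
  intros [Cf Of]; split.
  - intros x; apply continuous_Rmult; auto; apply continuous_cos.
  - intros k.
    generalize (is_RInt_lincomb _ _ _ _ (/ 2) (/ 2) _ _ (Of (k + 1)%Z) (Of (k - 1)%Z)).
    replace (/ 2 * 0 + / 2 * 0) with 0 by ring.
    apply is_RInt_eq_ext; intros x.
    rewrite plus_IZR, minus_IZR.
    replace ((IZR k + 1) * x) with (IZR k * x + x) by ring.
    replace ((IZR k - 1) * x) with (IZR k * x - x) by ring.
    rewrite cos_plus, cos_minus; field.
Qed.

(** The factor is a polynomial in [cos x], so multiplication by [cos] and linear combinations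
    suffice. At frequency [0] this makes the integral of [f] against every power of the peaking
    kernel vanish. *)
Lemma cos_orthogonal_mul_pow (f : R -> R) (c d : R) (n : nat) :
  cos_orthogonal f ->
  cos_orthogonal (fun x => f x * (d - (cos x - c) ^ 2 / 4) ^ n).
Proof.
  intros Hf; induction n as [|n IH].
  - apply cos_orthogonal_ext with f; auto; intros x; simpl; ring.
  - set (g := fun x => _) in IH.
    pose proof (cos_orthogonal_mul_cos _ IH) as H1.
    pose proof (cos_orthogonal_mul_cos _ H1) as H2.
    pose proof (cos_orthogonal_lincomb _ _ 1 (- / 4)
      (cos_orthogonal_lincomb _ _ (d - c ^ 2 / 4) (c / 2) IH H1) H2) as H3.
    refine (cos_orthogonal_ext _ _ _ H3); intros x; unfold g; simpl; field.
Qed.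

(** If [f x0 > 0], the integral of [f * p ^ n] is [0] by orthogonality, yet the part near [x0] grows
    like [(1 + d / 2) ^ n] while the rest stays above [- M * PI]. *)
Lemma cos_orthogonal_le0 (f : R -> R) (x0 : R) :
  cos_orthogonal f -> 0 < x0 < PI -> f x0 <= 0.
Proof.
  intros Hf Hx0; apply Rnot_lt_le; intros Hpos.
  destruct (Hf) as [Cf _].
  assert (Hr : exists r, 0 < r /\ 0 < x0 - r /\ x0 + r < PI /\
             forall x, Rabs (x - x0) < r -> f x0 / 2 < f x).
  { assert (He : 0 < f x0 / 2) by lra.
    destruct (proj1 (filterlim_locally _ _) (Cf x0) (mkposreal _ He)) as [r Hr].
    pose proof (cond_pos r) as Hr0.
    exists (Rmin r (Rmin (x0 / 2) ((PI - x0) / 2))).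
    pose proof (Rmin_l r (Rmin (x0 / 2) ((PI - x0) / 2))).
    pose proof (Rmin_r r (Rmin (x0 / 2) ((PI - x0) / 2))).
    pose proof (Rmin_l (x0 / 2) ((PI - x0) / 2)).
    pose proof (Rmin_r (x0 / 2) ((PI - x0) / 2)).
    repeat split; try lra.
    - repeat apply Rmin_pos; lra.
    - intros x Hx; assert (Hb : ball x0 r x) by (apply Rlt_le_trans with (1 := Hx); lra).
      specialize (Hr x Hb); change (Rabs (f x - f x0) < f x0 / 2) in Hr.
      apply Rabs_def2 in Hr; lra. }
  destruct Hr as (r & r0 & Hl & Hu & Hr).
  (* Strict monotonicity of [cos] on [[0, PI]] separates [cos x] from [c] by at least [m] once [x]
     is at distance [r] from [x0]. *)
  set (c := cos x0).
  pose (u := cos (x0 - r) - c); pose (v := c - cos (x0 + r)).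
  assert (u0 : 0 < u) by (unfold u, c; pose proof (cos_decreasing_1 (x0 - r) x0); lra).
  assert (v0 : 0 < v) by (unfold v, c; pose proof (cos_decreasing_1 x0 (x0 + r)); lra).
  pose (m := Rmin u v).
  assert (m0 : 0 < m) by (apply Rmin_pos; auto).
  assert (mu : m <= u) by apply Rmin_l.
  assert (mv : m <= v) by apply Rmin_r.
  (* This [d] gives [p <= 1] outside the [r]-neighbourhood of [x0], against [p x0 = 1 + d]. Dividing
     by [4] in [p] keeps it nonnegative, as two cosines differ by at most [2]. *)
  pose (d := m ^ 2 / 4).
  assert (d0 : 0 < d) by (unfold d; nra).
  pose (p := fun x => 1 + d - (cos x - c) ^ 2 / 4).
  assert (p0 : forall x, 0 <= p x).
  { intros x; unfold p, c; pose proof (COS_bound x); pose proof (COS_bound x0); nra. }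
  assert (pout : forall x, 0 <= x <= PI -> r <= Rabs (x - x0) -> p x <= 1).
  { intros x Hx Hrx; unfold p.
    assert (m <= Rabs (cos x - c)).
    { destruct (Rle_or_lt x x0).
      - rewrite Rabs_left1 in Hrx by lra.
        assert (cos (x0 - r) <= cos x) by (apply cos_decr_1; lra).
        rewrite Rabs_right; unfold u in *; lra.
      - rewrite Rabs_right in Hrx by lra.
        assert (cos x <= cos (x0 + r)) by (apply cos_decr_1; lra).
        rewrite Rabs_left1; unfold v in *; lra. }
    assert (m ^ 2 <= (cos x - c) ^ 2) by (rewrite <- (pow2_abs (cos x - c)); apply pow_incr; lra).
    unfold d; lra. }
  assert (Hs : exists s, 0 < s <= r / 2 /\ forall x, Rabs (x - x0) <= s -> 1 + d / 2 <= p x).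
  { assert (Cp : continuous p x0).
    { apply (ex_derive_continuous p); unfold p; auto_derive; auto. }
    assert (He : 0 < d / 2) by lra.
    destruct (proj1 (filterlim_locally _ _) Cp (mkposreal _ He)) as [s Hs].
    pose proof (cond_pos s) as Hs0.
    exists (Rmin (s / 2) (r / 2)).
    pose proof (Rmin_l (s / 2) (r / 2)); pose proof (Rmin_r (s / 2) (r / 2)).
    repeat split; try lra.
    - apply Rmin_pos; lra.
    - intros x Hx; assert (Hb : ball x0 s x) by (apply Rle_lt_trans with (1 := Hx); lra).
      specialize (Hs x Hb); change (Rabs (p x - p x0) < d / 2) in Hs.
      apply Rabs_def2 in Hs.
      assert (p x0 = 1 + d) by (unfold p, c; field); lra. }
  destruct Hs as (s & [s0 sr] & Hs).
  destruct (continuity_ab_min f 0 PI) as (xm & Hxm & _); [lra| |].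
  { intros x _; apply continuity_pt_filterlim; apply Cf. }
  pose (M := Rabs (f xm)).
  assert (HM : forall x, 0 <= x <= PI -> - M <= f x).
  { intros x Hx; specialize (Hxm x Hx); unfold M.
    pose proof (Rle_abs (- f xm)); rewrite Rabs_Ropp in *; lra. }
  assert (M0 : 0 <= M) by apply Rabs_pos.
  assert (Hlow : forall n x, 0 <= x <= PI -> - M <= f x * p x ^ n).
  { intros n x Hx; pose proof (pow_le (p x) n (p0 x)).
    destruct (Rlt_or_le (Rabs (x - x0)) r) as [Hin|Hout].
    - specialize (Hr x Hin); nra.
    - pose proof (pout x Hx Hout).
      assert (p x ^ n <= 1) by (rewrite <- (pow1 n); apply pow_incr; auto).
      specialize (HM x Hx); nra. }
  assert (Hhigh : forall n x, x0 - s <= x <= x0 + s ->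
            f x0 / 2 * (1 + d / 2) ^ n <= f x * p x ^ n).
  { intros n x Hx.
    assert (Rabs (x - x0) <= s) by (apply Rabs_le; lra).
    assert ((1 + d / 2) ^ n <= p x ^ n) by (apply pow_incr; split; [lra|auto]).
    assert (f x0 / 2 < f x) by (apply Hr; lra).
    assert (0 < (1 + d / 2) ^ n) by (apply pow_lt; lra).
    nra. }
  assert (Ex : forall n a b, ex_RInt (fun x => f x * p x ^ n) a b).
  { intros n a b; apply (ex_RInt_continuous (fun x => f x * p x ^ n)).
    intros x _; apply continuous_Rmult; auto.
    apply (ex_derive_continuous (fun y => p y ^ n)); unfold p; auto_derive; auto. }
  (* The interval is cut at [x0 - s] and [x0 + s]: the middle piece has length [2 * s] and integrand
     at least [f x0 / 2 * (1 + d / 2) ^ n], the outer ones have integrand at least [- M]. *)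
  assert (Hn : forall n, s * f x0 * (1 + d / 2) ^ n <= M * PI).
  { intros n.
    assert (I0 : RInt (fun x => f x * p x ^ n) 0 PI = 0).
    { apply is_RInt_unique.
      destruct (cos_orthogonal_mul_pow f c (1 + d) n Hf) as [_ H].
      generalize (H 0%Z); apply is_RInt_eq_ext; intros x.
      rewrite Rmult_0_l, cos_0; unfold p; ring. }
    rewrite <- (RInt_Chasles _ 0 (x0 - s) PI) in I0 by apply Ex.
    rewrite <- (RInt_Chasles _ (x0 - s) (x0 + s) PI) in I0 by apply Ex.
    change plus with Rplus in I0.
    assert (J1 : RInt (fun _ => - M) 0 (x0 - s) <= RInt (fun x => f x * p x ^ n) 0 (x0 - s)).
    { apply RInt_le; try lra; [apply ex_RInt_const|apply Ex|].
      intros x Hx; apply Hlow; lra. }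
    assert (J3 : RInt (fun _ => - M) (x0 + s) PI <= RInt (fun x => f x * p x ^ n) (x0 + s) PI).
    { apply RInt_le; try lra; [apply ex_RInt_const|apply Ex|].
      intros x Hx; apply Hlow; lra. }
    assert (J2 : RInt (fun _ => f x0 / 2 * (1 + d / 2) ^ n) (x0 - s) (x0 + s) <=
                 RInt (fun x => f x * p x ^ n) (x0 - s) (x0 + s)).
    { apply RInt_le; try lra; [apply ex_RInt_const|apply Ex|].
      intros x Hx; apply Hhigh; lra. }
    rewrite RInt_const in J1, J2, J3.
    unfold scal in J1, J2, J3; simpl in J1, J2, J3; unfold mult in J1, J2, J3; simpl in J1, J2, J3.
    nra. }
  assert (sf : 0 < s * f x0) by nra.
  (* Bernoulli's inequality turns the geometric growth into a linear one, so an Archimedean choice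
     of [n] contradicts [Hn]. *)
  destruct (INR_archimed (s * f x0 * (d / 2)) (M * PI)) as [n Hn']; [nra|].
  specialize (Hn n).
  pose proof (poly n (d / 2)) as Hb.
  assert (1 + INR n * (d / 2) <= (1 + d / 2) ^ n) by (apply Hb; lra).
  assert (s * f x0 * (1 + INR n * (d / 2)) <= s * f x0 * (1 + d / 2) ^ n)
    by (apply Rmult_le_compat_l; lra).
  nra.
Qed.

Lemma cos_orthogonal_eq0 (f : R -> R) (x : R) :
  cos_orthogonal f -> 0 < x < PI -> f x = 0.
Proof.
  intros Hf Hx; apply Rle_antisym; [now apply cos_orthogonal_le0|].
  assert (Hg : cos_orthogonal (fun x => (-1) * f x + 0 * f x))
    by now apply cos_orthogonal_lincomb.
  pose proof (cos_orthogonal_le0 _ x Hg Hx); simpl in *; lra.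
Qed.

Lemma continuous_eq0_closure (f : R -> R) :
  (forall x, continuous f x) -> (forall x, 0 < x < PI -> f x = 0) ->
  forall x, 0 <= x <= PI -> f x = 0.
Proof.
  intros Cf H0 x Hx; pose proof PI_RGT_0 as HPI.
  destruct (Req_dec (f x) 0) as [|Hne]; [assumption|exfalso].
  assert (He : 0 < Rabs (f x)) by now apply Rabs_pos_lt.
  destruct (proj1 (filterlim_locally _ _) (Cf x) (mkposreal _ He)) as [r Hr].
  pose proof (cond_pos r) as r0.
  pose (t := Rmin (r / 2) (PI / 4)).
  assert (Ht : 0 < t) by (apply Rmin_pos; lra).
  pose proof (Rmin_l (r / 2) (PI / 4) : t <= _); pose proof (Rmin_r (r / 2) (PI / 4) : t <= _).
  assert (Hy : exists y, 0 < y < PI /\ Rabs (y - x) < r).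
  { destruct (Rle_or_lt x (PI / 2)).
    - exists (x + t); split; [lra|]. replace (x + t - x) with t by ring.
      rewrite Rabs_right; lra.
    - exists (x - t); split; [lra|]. replace (x - t - x) with (- t) by ring.
      rewrite Rabs_Ropp, Rabs_right; lra. }
  destruct Hy as (y & Hy & Hyr).
  specialize (Hr y Hyr); change (Rabs (f y - f x) < Rabs (f x)) in Hr.
  rewrite (H0 y Hy) in Hr; replace (0 - f x) with (- f x) in Hr by ring.
  rewrite Rabs_Ropp in Hr; lra.
Qed.

(** * Complete systems and Fourier expansions *)

Definition complete_family (phi : nat -> R -> R) : Prop :=
  forall f : R -> R, (forall x, continuous f x) ->
    (forall k, is_RInt (fun x => f x * phi k x) 0 PI 0) ->
    forall x, 0 <= x <= PI -> f x = 0.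

(** Reduction to the cosines: if each [w x * cos (k x)] lies in the span of the [phi], then [f * w]
    is orthogonal to all cosines, hence zero inside the interval, and [w] can be divided out there.
    The endpoints, where [w] may vanish, follow by continuity. *)
Lemma complete_of_weight (phi : nat -> R -> R) (w : R -> R) :
  (forall x, continuous w x) -> (forall x, 0 < x < PI -> w x <> 0) ->
  (forall f : R -> R, (forall k, is_RInt (fun x => f x * phi k x) 0 PI 0) ->
     forall k : Z, is_RInt (fun x => f x * w x * cos (IZR k * x)) 0 PI 0) ->
  complete_family phi.
Proof.
  intros Cw Nw Hspan f Cf Hf; apply continuous_eq0_closure; auto.
  intros x Hx; assert (H : f x * w x = 0).
  { apply (cos_orthogonal_eq0 (fun x => f x * w x)); auto; split.
    - intros y; now apply continuous_Rmult.
    - now apply Hspan. }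
  apply Rmult_integral in H; destruct H; auto.
  now destruct (Nw x Hx).
Qed.

Lemma half_odd_S (k : nat) : half_odd (S k) = INR k + / 2.
Proof. unfold half_odd; rewrite S_INR; field. Qed.

Lemma complete_cos_int : complete_family (fun k x => cos (INR k * x)).
Proof.
  apply complete_of_weight with (fun _ => 1).
  - intros x; apply continuous_const.
  - intros; lra.
  - intros f Hf k.
    generalize (Hf (Z.abs_nat k)); apply is_RInt_eq_ext; intros x.
    rewrite INR_IZR_INZ, Zabs2Nat.id_abs, Rmult_1_r; f_equal.
    destruct (Z.abs_spec k) as [[_ ->]|[_ ->]]; auto.
    rewrite opp_IZR, <- cos_neg; f_equal; ring.
Qed.

Lemma is_RInt_zero (f : R -> R) (a b : R) :
  (forall x, f x = 0) -> is_RInt f a b 0.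
Proof.
  intros H; apply is_RInt_eq_ext with (fun _ => 0); auto.
  pose proof (is_RInt_const (V := R_NormedModule) a b 0) as H0.
  change (is_RInt (fun _ : R => 0) a b ((b - a) * 0)) in H0.
  now rewrite Rmult_0_r in H0.
Qed.

Lemma is_RInt_opp0 (f g : R -> R) (a b : R) :
  (forall x, g x = - f x) -> is_RInt f a b 0 -> is_RInt g a b 0.
Proof.
  intros E H; replace 0 with (- 0) by ring.
  apply is_RInt_eq_ext with (2 := is_RInt_opp _ _ _ _ H); intros; now rewrite E.
Qed.

Lemma is_RInt_lincomb0 (f g h : R -> R) (c d a b : R) :
  (forall x, h x = c * f x + d * g x) ->
  is_RInt f a b 0 -> is_RInt g a b 0 -> is_RInt h a b 0.
Proof.
  intros E Hf Hg; generalize (is_RInt_lincomb _ _ _ _ c d _ _ Hf Hg).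
  replace (c * 0 + d * 0) with 0 by ring.
  apply is_RInt_eq_ext; intros; now rewrite E.
Qed.

Lemma complete_sin_int : complete_family (fun k x => sin (INR (S k) * x)).
Proof.
  apply complete_of_weight with sin.
  - apply continuous_sin.
  - intros x Hx; apply Rgt_not_eq, sin_gt_0; lra.
  - intros f Hf.
    (* The product formula for [sin x * cos (k x)] involves the frequencies [k + 1] and [k - 1] for
       every integer [k]; oddness of the sine brings the negative ones back to the family, and
       frequency [0] contributes nothing. *)
    assert (HZ : forall k : Z, is_RInt (fun x => f x * sin (IZR k * x)) 0 PI 0).
    { intros k; destruct (Z_dec k 0) as [[Hk|Hk]|Hk].
      - apply is_RInt_opp0 with (2 := Hf (pred (Z.to_nat (- k)))); intros x.
        rewrite Nat.succ_pred by lia; rewrite INR_IZR_INZ, Z2Nat.id by lia.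
        rewrite opp_IZR, Ropp_mult_distr_r, <- sin_neg; do 2 f_equal; ring.
      - apply is_RInt_eq_ext with (2 := Hf (pred (Z.to_nat k))); intros x.
        rewrite Nat.succ_pred by lia; now rewrite INR_IZR_INZ, Z2Nat.id by lia.
      - subst k; apply is_RInt_zero; intros x; rewrite Rmult_0_l, sin_0; ring. }
    intros k; apply is_RInt_lincomb0 with (2 := HZ (k + 1)%Z) (3 := HZ (k - 1)%Z)
      (c := / 2) (d := - / 2); intros x.
    rewrite plus_IZR, minus_IZR.
    replace ((IZR k + 1) * x) with (IZR k * x + x) by ring.
    replace ((IZR k - 1) * x) with (IZR k * x - x) by ring.
    rewrite sin_plus, sin_minus; field.
Qed.

Lemma half_Z_cases (k : Z) :
  (exists n, IZR k + / 2 = half_odd (S n)) \/ (exists n, IZR k + / 2 = - half_odd (S n)).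
Proof.
  destruct (Z_lt_le_dec k 0) as [Hk|Hk].
  - right; exists (Z.to_nat (- k - 1)); rewrite half_odd_S, INR_IZR_INZ, Z2Nat.id by lia.
    rewrite minus_IZR, opp_IZR; field.
  - left; exists (Z.to_nat k); now rewrite half_odd_S, INR_IZR_INZ, Z2Nat.id by lia.
Qed.

Lemma complete_cos_half : complete_family (fun k x => cos (half_odd (S k) * x)).
Proof.
  apply complete_of_weight with (fun x => cos (x / 2)).
  - intros x; apply (ex_derive_continuous (fun x => cos (x / 2))); auto_derive; auto.
  - intros x Hx; apply Rgt_not_eq, cos_gt_0; lra.
  - intros f Hf.
    assert (HZ : forall k : Z, is_RInt (fun x => f x * cos ((IZR k + / 2) * x)) 0 PI 0).
    { intros k; destruct (half_Z_cases k) as [[n ->]|[n ->]].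
      - apply Hf.
      - apply is_RInt_eq_ext with (2 := Hf n); intros x.
        rewrite <- cos_neg; do 2 f_equal; ring. }
    intros k; apply is_RInt_lincomb0 with (2 := HZ k) (3 := HZ (k - 1)%Z)
      (c := / 2) (d := / 2); intros x.
    rewrite minus_IZR.
    replace ((IZR k + / 2) * x) with (IZR k * x + x / 2) by field.
    replace ((IZR k - 1 + / 2) * x) with (IZR k * x - x / 2) by field.
    rewrite cos_plus, cos_minus; field.
Qed.

Lemma complete_sin_half : complete_family (fun k x => sin (half_odd (S k) * x)).
Proof.
  apply complete_of_weight with (fun x => sin (x / 2)).
  - intros x; apply (ex_derive_continuous (fun x => sin (x / 2))); auto_derive; auto.
  - intros x Hx; apply Rgt_not_eq, sin_gt_0; lra.
  - intros f Hf.
    assert (HZ : forall k : Z, is_RInt (fun x => f x * sin ((IZR k + / 2) * x)) 0 PI 0).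
    { intros k; destruct (half_Z_cases k) as [[n ->]|[n ->]].
      - apply Hf.
      - apply is_RInt_opp0 with (2 := Hf n); intros x.
        rewrite Ropp_mult_distr_r, <- sin_neg; do 2 f_equal; ring. }
    intros k; apply is_RInt_lincomb0 with (2 := HZ k) (3 := HZ (k - 1)%Z)
      (c := / 2) (d := - / 2); intros x.
    rewrite minus_IZR.
    replace ((IZR k + / 2) * x) with (IZR k * x + x / 2) by field.
    replace ((IZR k - 1 + / 2) * x) with (IZR k * x - x / 2) by field.
    rewrite sin_plus, sin_minus; field.
Qed.

(** Completeness is stated for functions continuous on the whole line, whereas limits are controlled
    only on [[0, PI]]; composing with this retraction extends them continuously. *)
Definition clamp (x : R) : R := Rmax 0 (Rmin PI x).

Lemma clamp_bounds (x : R) : 0 <= clamp x <= PI.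
Proof.
  pose proof PI_RGT_0; unfold clamp; split; [apply Rmax_l|].
  apply Rmax_lub; [lra|apply Rmin_l].
Qed.

Lemma clamp_id (x : R) : 0 <= x <= PI -> clamp x = x.
Proof. intros H; unfold clamp; rewrite Rmin_right, Rmax_right; lra. Qed.

Lemma continuous_clamp (x : R) : continuous clamp x.
Proof.
  pose proof PI_RGT_0.
  apply filterlim_locally; intros e; exists e; intros y Hy.
  change (Rabs (y - x) < e) in Hy; change (Rabs (clamp y - clamp x) < e).
  apply Rle_lt_trans with (2 := Hy).
  unfold clamp, Rmin; destruct (Rle_dec PI x), (Rle_dec PI y);
    unfold Rmax; repeat match goal with |- context [Rle_dec ?a ?b] => destruct (Rle_dec a b) end;
    unfold Rabs; repeat match goal with |- context [Rcase_abs ?a] => destruct (Rcase_abs a) end; lra.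
Qed.

Lemma is_lim_seq_eventually_lt (u : nat -> R) (e : R) :
  is_lim_seq u 0 -> 0 < e -> exists N, forall n, (N <= n)%nat -> u n < e.
Proof.
  intros H He; destruct (proj2 (is_lim_seq_spec _ _) H (mkposreal e He)) as [N HN].
  exists N; intros n Hn; specialize (HN n Hn); simpl in HN.
  apply Rabs_def2 in HN; lra.
Qed.

(** Uniform convergence passes both continuity and the integrals against the bounded [phi k] to the
    limit, so every coefficient of the limit is [0] and completeness applies. *)
Lemma complete_uniform_limit (phi : nat -> R -> R) (D : R -> R)
  (DN : nat -> R -> R) (I : nat -> nat -> R) (eps : nat -> R) :
  complete_family phi ->
  (forall k x, continuous (phi k) x) -> (forall k x, Rabs (phi k x) <= 1) ->
  (forall N x, continuous (DN N) x) -> is_lim_seq eps 0 ->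
  (forall N x, 0 <= x <= PI -> Rabs (DN N x - D x) <= eps N) ->
  (forall N k, is_RInt (fun x => DN N x * phi k x) 0 PI (I N k)) ->
  (forall k, is_lim_seq (fun N => I N k) 0) ->
  forall x, 0 <= x <= PI -> D x = 0.
Proof.
  intros Hphi Cphi Bphi CD Heps HD HI Hlim; pose proof PI_RGT_0.
  pose (f := fun x => D (clamp x)).
  assert (Cf : forall x, continuous f x).
  { intros x; apply filterlim_locally; intros e.
    pose proof (cond_pos e) as He.
    assert (He3 : 0 < e / 3) by lra.
    destruct (is_lim_seq_eventually_lt _ _ Heps He3) as [N HN].
    specialize (HN N (le_n N)).
    assert (CN : continuous (fun y => DN N (clamp y)) x)
      by (apply continuous_comp; [apply continuous_clamp|apply CD]).
    generalize (proj1 (filterlim_locally _ _) CN (mkposreal _ He3)).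
    apply filter_imp; intros y Hy.
    change (Rabs (DN N (clamp y) - DN N (clamp x)) < e / 3) in Hy.
    change (Rabs (f y - f x) < e); unfold f.
    pose proof (HD N _ (clamp_bounds x)) as Hx; pose proof (HD N _ (clamp_bounds y)) as Hy'.
    apply Rabs_def2 in Hy.
    pose proof (Rle_lt_trans _ _ _ Hx HN) as Hx1; pose proof (Rle_lt_trans _ _ _ Hy' HN) as Hy1.
    apply Rabs_def2 in Hx1; apply Rabs_def2 in Hy1.
    apply Rabs_def1; lra. }
  assert (Hf : forall x, 0 <= x <= PI -> f x = 0).
  { apply Hphi; auto; intros k.
    assert (Ex : ex_RInt (fun x => f x * phi k x) 0 PI).
    { apply (ex_RInt_continuous (fun x => f x * phi k x)); intros x _.
      now apply continuous_Rmult. }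
    destruct Ex as [v Hv].
    assert (Hd : forall N, Rabs (I N k - v) <= PI * eps N).
    { intros N.
      pose proof (is_RInt_lincomb _ _ _ _ 1 (-1) _ _ (HI N k) Hv) as Hm.
      replace (I N k - v) with (1 * I N k + -1 * v) by ring.
      rewrite <- (is_RInt_unique _ _ _ _ Hm).
      replace PI with (PI - 0) at 2 by ring.
      apply abs_RInt_le_const; [lra|now exists (1 * I N k + -1 * v)|]; intros x Hx.
      replace (1 * (DN N x * phi k x) + -1 * (f x * phi k x))
        with ((DN N x - f x) * phi k x) by ring.
      rewrite Rabs_mult; unfold f; rewrite clamp_id by assumption.
      rewrite <- (Rmult_1_r (eps N)); apply Rmult_le_compat; auto using Rabs_pos. }
    (* The coefficients [I N k] tend both to the coefficient [v] of the limit and to [0]; hence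
       [v = 0]. *)
    assert (L : is_lim_seq (fun N => I N k) v).
    { apply is_lim_seq_spec; intros e; simpl.
      assert (He : 0 < e / PI) by (apply Rdiv_lt_0_compat; [apply cond_pos|lra]).
      destruct (is_lim_seq_eventually_lt _ _ Heps He) as [N HN].
      exists N; intros n Hn; apply Rle_lt_trans with (1 := Hd n).
      replace (pos e) with (PI * (e / PI)) by (field; lra).
      apply Rmult_lt_compat_l; auto. }
    apply is_lim_seq_unique in L; pose proof (is_lim_seq_unique _ _ (Hlim k)) as L'.
    rewrite L in L'; injection L'; intros E; now rewrite E in Hv. }
  intros x Hx; rewrite <- (clamp_id x Hx); apply (Hf x Hx).
Qed.

Record fourier_basis (phi : nat -> R -> R) (m : nat -> R) : Prop := {
  basis_complete : complete_family phi;
  basis_continuous : forall k x, continuous (phi k) x;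
  basis_bounded : forall k x, Rabs (phi k x) <= 1;
  basis_norm : forall k, is_RInt (fun x => phi k x * phi k x) 0 PI (m k);
  basis_orthogonal : forall j k, j <> k -> is_RInt (fun x => phi j x * phi k x) 0 PI 0
}.

Lemma sum_n_Rplus (a : nat -> R) (n : nat) : sum_n a (S n) = sum_n a n + a (S n) :> R.
Proof. exact (sum_Sn a n). Qed.

Lemma is_RInt_sum_n (f : nat -> R -> R) (I : nat -> R) (a b : R) :
  (forall n, is_RInt (f n) a b (I n)) ->
  forall N, is_RInt (fun x => sum_n (fun n => f n x) N) a b (sum_n I N).
Proof.
  intros H N; induction N as [|N IH].
  - rewrite sum_O; apply is_RInt_eq_ext with (2 := H 0%nat); intros; now rewrite sum_O.
  - rewrite sum_Sn; apply is_RInt_eq_ext with (2 := is_RInt_plus _ _ _ _ _ _ IH (H (S N))).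
    intros; now rewrite sum_Sn.
Qed.

Lemma continuous_sum_n (f : nat -> R -> R) (x : R) :
  (forall n, continuous (f n) x) ->
  forall N, continuous (fun x => sum_n (fun n => f n x) N) x.
Proof.
  intros H N; induction N as [|N IH].
  - apply continuous_ext with (2 := H 0%nat); intros; now rewrite sum_O.
  - apply continuous_ext with (2 := continuous_plus _ _ _ IH (H (S N))).
    intros; now rewrite sum_Sn.
Qed.

Lemma sum_n_mult_r_R (a : nat -> R) (c : R) (N : nat) :
  sum_n a N * c = sum_n (fun n => a n * c) N :> R.
Proof. now rewrite <- (sum_n_mult_r (K := R_Ring)). Qed.

Lemma sum_n_single (a : nat -> R) (k N : nat) :
  (k <= N)%nat -> sum_n (fun j => if Nat.eqb j k then a j else 0) N = a k :> R.
Proof.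
  assert (Z : forall M, (M < k)%nat -> sum_n (fun j => if Nat.eqb j k then a j else 0) M = 0 :> R).
  { induction M as [|M IH]; intros HM.
    - rewrite sum_O; destruct (Nat.eqb_spec 0 k); auto; lia.
    - rewrite sum_n_Rplus, IH by lia; destruct (Nat.eqb_spec (S M) k); [lia|ring]. }
  induction N as [|N IH]; intros HN.
  - rewrite sum_O; destruct (Nat.eqb_spec 0 k); [now subst|lia].
  - rewrite sum_n_Rplus; destruct (Nat.eqb_spec (S N) k) as [E|E].
    + rewrite Z by lia; subst; ring.
    + rewrite IH by lia; ring.
Qed.

Lemma ex_series_dominated (a b : nat -> R) :
  (forall n, Rabs (a n) <= b n) -> ex_series b -> ex_series a.
Proof. exact (ex_series_le (V := R_CompleteNormedModule) a b). Qed.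

Lemma sum_n_tail_le (a b : nat -> R) (la lb : R) (N : nat) :
  (forall n, Rabs (a n) <= b n) -> is_series a la -> is_series b lb ->
  Rabs (sum_n a N - la) <= lb - sum_n b N.
Proof.
  intros H Ha Hb.
  assert (T : forall (u : nat -> R) (l : R), is_series u l ->
            is_series (fun k => u (S N + k)%nat) (l - sum_n u N)).
  { intros u l Hu; apply (is_series_incr_n u (S N)); [lia|]; simpl pred.
    change (is_series u (l - sum_n u N + sum_n u N)).
    now replace (l - sum_n u N + sum_n u N) with l by ring. }
  apply T in Ha; apply T in Hb.
  assert (Ex : ex_series (fun k => Rabs (a (S N + k)%nat))).
  { apply ex_series_dominated with (fun k => b (S N + k)%nat); [|eexists; apply Hb].
    intros n; rewrite Rabs_Rabsolu; apply H. }
  replace (sum_n a N - la) with (- (la - sum_n a N)) by ring; rewrite Rabs_Ropp.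
  rewrite <- (is_series_unique _ _ Ha), <- (is_series_unique _ _ Hb).
  apply Rle_trans with (1 := Series_Rabs _ Ex).
  apply Series_le; [|eexists; apply Hb].
  intros n; split; [apply Rabs_pos|apply H].
Qed.

(** Here [Q] is a function series and [P] an explicit correction. The difference [Q - P] minus the
    proposed expansion is a uniform limit of partial sums whose coefficients tend to [0]. Only
    uniform convergence is asked of the series for [Q], while absolute convergence is asked of the
    [c k]. *)
Theorem fourier_expansion (phi : nat -> R -> R) (m : nat -> R) (q : nat -> R -> R)
  (Q P : R -> R) (c p : nat -> R) (I : nat -> nat -> R) (eps : nat -> R) :
  fourier_basis phi m ->
  (forall n x, continuous (q n) x) -> (forall x, continuous P x) ->
  is_lim_seq eps 0 ->
  (forall N x, 0 <= x <= PI -> Rabs (sum_n (fun n => q n x) N - Q x) <= eps N) ->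
  (forall n k, is_RInt (fun x => q n x * phi k x) 0 PI (I n k)) ->
  (forall k, is_RInt (fun x => P x * phi k x) 0 PI (p k)) ->
  (forall k, is_series (fun n => I n k) (m k * c k + p k)) ->
  ex_series (fun k => Rabs (c k)) ->
  forall x, 0 <= x <= PI -> is_series (fun k => c k * phi k x) (Q x - P x).
Proof.
  intros [Hphi Cphi Bphi Nphi Ophi] Cq CP Heps HQ HI Hp Hs [lc Hc].
  assert (Bc : forall x k, Rabs (c k * phi k x) <= Rabs (c k)).
  { intros x k; rewrite Rabs_mult.
    pose proof (Bphi k x); pose proof (Rabs_pos (c k)); nra. }
  assert (Ex : forall x, ex_series (fun k => c k * phi k x)).
  { intros x; apply ex_series_dominated with (fun k => Rabs (c k)); [|eexists; apply Hc].
    intros n; apply Bc. }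
  pose (D := fun x => Q x - P x - Series (fun k => c k * phi k x)).
  assert (HD : forall x, 0 <= x <= PI -> D x = 0).
  { apply complete_uniform_limit with (phi := phi)
      (DN := fun N x => 1 * (1 * sum_n (fun n => q n x) N + (-1) * P x)
                        + (-1) * sum_n (fun k => c k * phi k x) N)
      (eps := fun N => eps N + (lc - sum_n (fun k => Rabs (c k)) N))
      (* By orthogonality only the index [k] of the expansion contributes; the conditional records
         that it is present only once [N >= k]. *)
      (I := fun N k => 1 * (1 * sum_n (fun n => I n k) N + (-1) * p k)
              + (-1) * sum_n (fun j => if Nat.eqb j k then c j * m j else 0) N); auto.
    - intros N x; apply continuous_lincomb; [apply continuous_lincomb; auto|].
      + now apply continuous_sum_n.
      + apply continuous_sum_n; intros n; apply continuous_Rmult; auto; apply continuous_const.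
    - replace (Finite 0) with (Finite (0 + (lc - lc))) by (f_equal; ring).
      apply is_lim_seq_plus'; auto.
      apply is_lim_seq_minus'; [apply is_lim_seq_const|exact Hc].
    - intros N x Hx; unfold D.
      pose proof (sum_n_tail_le _ _ _ _ N (Bc x) (Series_correct _ (Ex x)) Hc) as H1.
      specialize (HQ N x Hx).
      replace (1 * (1 * sum_n (fun n : nat => q n x) N + -1 * P x) +
        -1 * sum_n (fun k : nat => c k * phi k x) N -
        (Q x - P x - Series (fun k : nat => c k * phi k x))) with
       ((sum_n (fun n => q n x) N - Q x) + - (sum_n (fun k => c k * phi k x) N
          - Series (fun k => c k * phi k x))) by ring.
      apply Rle_trans with (1 := Rabs_triang _ _); rewrite Rabs_Ropp; lra.
    - intros N k.
      pose proof (is_RInt_sum_n _ _ 0 PI (fun n => HI n k) N) as H1.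
      assert (HJ : forall j, is_RInt (fun x => c j * phi j x * phi k x) 0 PI
                 (if Nat.eqb j k then c j * m j else 0)).
      { intros j; destruct (Nat.eqb_spec j k) as [->|Hjk].
        - apply is_RInt_eq_ext with (2 := is_RInt_scal _ _ _ (c k) _ (Nphi k)).
          intros x; unfold scal; simpl; unfold mult; simpl; ring.
        - apply is_RInt_lincomb0 with (2 := Ophi j k Hjk) (3 := Ophi j k Hjk) (c := c j) (d := 0).
          intros x; ring. }
      pose proof (is_RInt_sum_n _ _ 0 PI HJ N) as H2.
      apply is_RInt_eq_ext with (2 := is_RInt_lincomb _ _ _ _ 1 (-1) _ _
        (is_RInt_lincomb _ _ _ _ 1 (-1) _ _ H1 (Hp k)) H2).
      intros x; rewrite <- !sum_n_mult_r_R; ring.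
    - intros k.
      replace (Finite 0) with (Finite (1 * (1 * (m k * c k + p k) + (-1) * p k) + (-1) * (c k * m k)))
        by (f_equal; ring).
      assert (Hsc : forall u (a l : R), is_lim_seq u l -> is_lim_seq (fun n => a * u n) (a * l))
        by (intros u a l Hu; apply (is_lim_seq_scal_l u a l Hu)).
      apply is_lim_seq_plus'; [apply Hsc, is_lim_seq_plus'; apply Hsc|apply Hsc].
      + exact (Hs k).
      + apply is_lim_seq_const.
      + apply is_lim_seq_ext_loc with (fun _ => c k * m k); [|apply is_lim_seq_const].
        exists k; intros n Hn; symmetry; apply (sum_n_single (fun j => c j * m j)); auto. }
  intros x Hx; replace (Q x - P x) with (Series (fun k => c k * phi k x)).
  - apply Series_correct, Ex.
  - specialize (HD x Hx); unfold D in HD; lra.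
Qed.

(** * The four trigonometric systems *)

Lemma is_RInt_antiderivative (F f : R -> R) (a b : R) :
  (forall x, is_derive F x (f x)) -> (forall x, continuous f x) ->
  is_RInt f a b (F b - F a).
Proof. intros HF Hf; apply (is_RInt_derive F f); auto. Qed.

Lemma is_RInt_one : is_RInt (fun _ => 1) 0 PI PI.
Proof.
  generalize (is_RInt_antiderivative (fun x => x) (fun _ => 1) 0 PI); rewrite Rminus_0_r.
  intros H; apply H; intros x; [auto_derive; auto|apply continuous_const].
Qed.

(** The Wronskian [u' v - u v'] has derivative [(A - B) u v] when [u'' = A u] and [v'' = B v]. Both
    the orthogonality relations ([A = - j^2], [B = - k^2]) and the coefficients of the hyperbolic
    kernels ([A = a^2], [B = - k^2]) are instances. *)
Lemma is_RInt_ode (u u1 v v1 : R -> R) (A B a b : R) :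
  A <> B ->
  (forall x, is_derive u x (u1 x)) -> (forall x, is_derive u1 x (A * u x)) ->
  (forall x, is_derive v x (v1 x)) -> (forall x, is_derive v1 x (B * v x)) ->
  is_RInt (fun x => u x * v x) a b
    ((u1 b * v b - u b * v1 b - (u1 a * v a - u a * v1 a)) / (A - B)).
Proof.
  intros HAB Hu Hu1 Hv Hv1.
  assert (C : forall f f1 : R -> R, (forall x, is_derive f x (f1 x)) -> forall x, continuous f x).
  { intros f f1 H x; apply (ex_derive_continuous f); exists (f1 x); apply H. }
  replace ((u1 b * v b - u b * v1 b - (u1 a * v a - u a * v1 a)) / (A - B))
    with ((u1 b * v b - u b * v1 b) / (A - B) - (u1 a * v a - u a * v1 a) / (A - B))
    by (field; lra).
  apply (is_RInt_antiderivative (fun x => (u1 x * v x - u x * v1 x) / (A - B))).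
  - intros x; auto_derive.
    + repeat split; eexists; auto.
    + rewrite (is_derive_unique (fun y : R => u y) _ _ (Hu x)),
        (is_derive_unique (fun y : R => u1 y) _ _ (Hu1 x)),
        (is_derive_unique (fun y : R => v y) _ _ (Hv x)),
        (is_derive_unique (fun y : R => v1 y) _ _ (Hv1 x)); field; lra.
  - intros x; apply continuous_Rmult; eapply C; eauto.
Qed.

Lemma is_derive_cos_freq (k x : R) : is_derive (fun x => cos (k * x)) x (- k * sin (k * x)).
Proof. auto_derive; auto; ring. Qed.

Lemma is_derive_cos_freq2 (k x : R) :
  is_derive (fun x => - k * sin (k * x)) x (- k ^ 2 * cos (k * x)).
Proof. auto_derive; auto; ring. Qed.

Lemma is_derive_sin_freq (k x : R) : is_derive (fun x => sin (k * x)) x (k * cos (k * x)).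
Proof. auto_derive; auto; ring. Qed.

Lemma is_derive_sin_freq2 (k x : R) :
  is_derive (fun x => k * cos (k * x)) x (- k ^ 2 * sin (k * x)).
Proof. auto_derive; auto; ring. Qed.

Lemma cos_sin_INR_PI (n : nat) : cos (INR n * PI) = (-1) ^ n /\ sin (INR n * PI) = 0.
Proof.
  induction n as [|n [IHc IHs]].
  - simpl; rewrite Rmult_0_l, cos_0, sin_0; auto.
  - rewrite S_INR; replace ((INR n + 1) * PI) with (INR n * PI + PI) by ring.
    rewrite neg_cos, neg_sin, IHc, IHs; simpl; split; ring.
Qed.

Lemma cos_sin_half_PI (n : nat) :
  cos (half_odd (S n) * PI) = 0 /\ sin (half_odd (S n) * PI) = (-1) ^ n.
Proof.
  destruct (cos_sin_INR_PI n) as [Hc Hs].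
  rewrite half_odd_S; replace ((INR n + / 2) * PI) with (INR n * PI + PI / 2) by field.
  rewrite cos_plus, sin_plus, cos_PI2, sin_PI2, Hc, Hs; split; ring.
Qed.

(** The Wronskian formula degenerates at equal frequencies, hence an explicit antiderivative. The
    vanishing product covers both integer [k] (the sine is zero) and half-integer [k] (the cosine is
    zero). *)
Lemma is_RInt_cos_sqr (k : R) :
  k <> 0 -> sin (k * PI) * cos (k * PI) = 0 ->
  is_RInt (fun x => cos (k * x) * cos (k * x)) 0 PI (PI / 2).
Proof.
  intros Hk H0.
  replace (PI / 2) with ((PI / 2 + sin (k * PI) * cos (k * PI) / (2 * k))
     - (0 / 2 + sin (k * 0) * cos (k * 0) / (2 * k)))
    by (rewrite H0, Rmult_0_r, sin_0; field; auto).
  apply (is_RInt_antiderivative (fun x => x / 2 + sin (k * x) * cos (k * x) / (2 * k))).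
  - intros x; auto_derive; auto.
    pose proof (sin2_cos2 (k * x)) as E; unfold Rsqr in E.
    replace (cos (k * x) * cos (k * x)) with (1 - sin (k * x) * sin (k * x)) by lra.
    transitivity (/ 2 + (cos (k * x) * cos (k * x) - sin (k * x) * sin (k * x)) / 2).
    + field; auto.
    + lra.
  - intros x; apply (ex_derive_continuous (fun x => cos (k * x) * cos (k * x))); auto_derive; auto.
Qed.

Lemma is_RInt_sin_sqr (k : R) :
  k <> 0 -> sin (k * PI) * cos (k * PI) = 0 ->
  is_RInt (fun x => sin (k * x) * sin (k * x)) 0 PI (PI / 2).
Proof.
  intros Hk H0.
  replace (PI / 2) with (1 * PI + (-1) * (PI / 2)) by field.
  apply is_RInt_eq_ext with (2 := is_RInt_lincomb _ _ _ _ 1 (-1) _ _ is_RInt_one (is_RInt_cos_sqr k Hk H0)).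
  intros x; pose proof (sin2_cos2 (k * x)) as E; unfold Rsqr in E; lra.
Qed.

Lemma Rabs_cos_le1 (x : R) : Rabs (cos x) <= 1.
Proof. apply Rabs_le, COS_bound. Qed.

Lemma Rabs_sin_le1 (x : R) : Rabs (sin x) <= 1.
Proof. apply Rabs_le, SIN_bound. Qed.

Lemma is_RInt_cos_cos (j k : R) :
  j ^ 2 <> k ^ 2 -> j * sin (j * PI) * cos (k * PI) = k * cos (j * PI) * sin (k * PI) ->
  is_RInt (fun x => cos (j * x) * cos (k * x)) 0 PI 0.
Proof.
  intros Hjk Hb.
  assert (N : - j ^ 2 <> - k ^ 2) by lra.
  pose proof (is_RInt_ode _ _ _ _ _ _ 0 PI N (is_derive_cos_freq j) (is_derive_cos_freq2 j)
    (is_derive_cos_freq k) (is_derive_cos_freq2 k)) as H; simpl in H.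
  match type of H with is_RInt _ _ _ ?l => replace l with 0 in H; [exact H|] end.
  rewrite !Rmult_0_r, sin_0.
  match goal with |- 0 = ?n / _ => replace n with 0 by lra end.
  unfold Rdiv; ring.
Qed.

Lemma is_RInt_sin_sin (j k : R) :
  j ^ 2 <> k ^ 2 -> j * cos (j * PI) * sin (k * PI) = k * sin (j * PI) * cos (k * PI) ->
  is_RInt (fun x => sin (j * x) * sin (k * x)) 0 PI 0.
Proof.
  intros Hjk Hb.
  assert (N : - j ^ 2 <> - k ^ 2) by lra.
  pose proof (is_RInt_ode _ _ _ _ _ _ 0 PI N (is_derive_sin_freq j) (is_derive_sin_freq2 j)
    (is_derive_sin_freq k) (is_derive_sin_freq2 k)) as H; simpl in H.
  match type of H with is_RInt _ _ _ ?l => replace l with 0 in H; [exact H|] end.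
  rewrite !Rmult_0_r, sin_0.
  match goal with |- 0 = ?n / _ => replace n with 0 by lra end.
  unfold Rdiv; ring.
Qed.

Lemma sqr_neq_pos (a b : R) : 0 <= a -> 0 <= b -> a <> b -> a ^ 2 <> b ^ 2.
Proof.
  intros Ha Hb Hab E; apply Hab.
  rewrite <- (sqrt_pow2 a), <- (sqrt_pow2 b) by assumption; now rewrite E.
Qed.

Lemma half_odd_S_ge (k : nat) : / 2 <= half_odd (S k).
Proof. rewrite half_odd_S; pose proof (pos_INR k); lra. Qed.

Lemma half_odd_S_inj (j k : nat) : j <> k -> half_odd (S j) <> half_odd (S k).
Proof. intros H E; apply H, INR_eq; rewrite !half_odd_S in E; lra. Qed.

Lemma continuous_cos_freq (k x : R) : continuous (fun x => cos (k * x)) x.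
Proof. apply (ex_derive_continuous (fun x => cos (k * x))); eexists; apply is_derive_cos_freq. Qed.

Lemma continuous_sin_freq (k x : R) : continuous (fun x => sin (k * x)) x.
Proof. apply (ex_derive_continuous (fun x => sin (k * x))); eexists; apply is_derive_sin_freq. Qed.

Definition cos_int_norm (k : nat) : R := match k with O => PI | _ => PI / 2 end.

Lemma basis_cos_int : fourier_basis (fun k x => cos (INR k * x)) cos_int_norm.
Proof.
  split.
  - apply complete_cos_int.
  - intros; apply continuous_cos_freq.
  - intros; apply Rabs_cos_le1.
  - intros [|k]; unfold cos_int_norm.
    + apply is_RInt_eq_ext with (fun _ => 1).
      * intros x; simpl; rewrite Rmult_0_l, cos_0; ring.
      * apply is_RInt_one.
    + apply is_RInt_cos_sqr; [apply not_0_INR; lia|].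
      rewrite (proj2 (cos_sin_INR_PI _)); ring.
  - intros j k Hjk; apply is_RInt_cos_cos.
    + apply sqr_neq_pos; auto using pos_INR; now apply not_INR.
    + rewrite !(proj2 (cos_sin_INR_PI _)); ring.
Qed.

Lemma basis_sin_int : fourier_basis (fun k x => sin (INR (S k) * x)) (fun _ => PI / 2).
Proof.
  split.
  - apply complete_sin_int.
  - intros; apply continuous_sin_freq.
  - intros; apply Rabs_sin_le1.
  - intros k; apply is_RInt_sin_sqr; [apply not_0_INR; lia|].
    rewrite (proj2 (cos_sin_INR_PI _)); ring.
  - intros j k Hjk; apply is_RInt_sin_sin.
    + apply sqr_neq_pos; auto using pos_INR; apply not_INR; lia.
    + rewrite !(proj2 (cos_sin_INR_PI _)); ring.
Qed.

Lemma basis_cos_half : fourier_basis (fun k x => cos (half_odd (S k) * x)) (fun _ => PI / 2).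
Proof.
  split.
  - apply complete_cos_half.
  - intros; apply continuous_cos_freq.
  - intros; apply Rabs_cos_le1.
  - intros k; apply is_RInt_cos_sqr; [pose proof (half_odd_S_ge k); lra|].
    rewrite (proj1 (cos_sin_half_PI _)); ring.
  - intros j k Hjk; apply is_RInt_cos_cos.
    + pose proof (half_odd_S_ge k); pose proof (half_odd_S_ge j).
      apply sqr_neq_pos; try lra; now apply half_odd_S_inj.
    + rewrite !(proj1 (cos_sin_half_PI _)); ring.
Qed.

Lemma basis_sin_half : fourier_basis (fun k x => sin (half_odd (S k) * x)) (fun _ => PI / 2).
Proof.
  split.
  - apply complete_sin_half.
  - intros; apply continuous_sin_freq.
  - intros; apply Rabs_sin_le1.
  - intros k; apply is_RInt_sin_sqr; [pose proof (half_odd_S_ge k); lra|].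
    rewrite (proj1 (cos_sin_half_PI _)); ring.
  - intros j k Hjk; apply is_RInt_sin_sin.
    + pose proof (half_odd_S_ge k); pose proof (half_odd_S_ge j).
      apply sqr_neq_pos; try lra; now apply half_odd_S_inj.
    + rewrite !(proj1 (cos_sin_half_PI _)); ring.
Qed.

(** * Hyperbolic kernels and their Fourier coefficients *)

Lemma is_derive_cosh (x : R) : is_derive cosh x (sinh x).
Proof. unfold cosh, sinh; auto_derive; auto; field. Qed.

Lemma is_derive_sinh (x : R) : is_derive sinh x (cosh x).
Proof. unfold cosh, sinh; auto_derive; auto; field. Qed.

Lemma cosh_plus_sinh (x : R) : cosh x + sinh x = exp x.
Proof. unfold cosh, sinh; field. Qed.

Lemma sinh_pos (x : R) : 0 < x -> 0 < sinh x.
Proof. intros H; unfold sinh; pose proof (exp_increasing (- x) x); lra. Qed.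

Lemma cosh_pos (x : R) : 0 < cosh x.
Proof. unfold cosh; pose proof (exp_pos x); pose proof (exp_pos (- x)); lra. Qed.

(* For [W = +- w (a PI)], [w = image_weight sinh] or [image_weight cosh], and [g = cosh] or [sinh],
   this is one of [cosh (a (PI - x)) / sinh (a PI)], [sinh (a (PI - x)) / cosh (a PI)],
   [sinh (a (PI - x)) / sinh (a PI)], [cosh (a (PI - x)) / cosh (a PI)].  The split form isolates
   the dependence on the period. *)
Definition kernel (W a : R) (g : R -> R) (x : R) : R := exp (- (a * x)) + W * g (a * x).

(** For [t > 0] this sums the geometric series of the images: [2 * sum_(j >= 1) exp (- 2 j t)] for
    [h = sinh], and the same with signs [(-1)^(j-1)] for [h = cosh]. *)
Definition image_weight (h : R -> R) (t : R) : R := exp (- t) / h t.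

Definition kernel1 (W a : R) (g1 : R -> R) (x : R) : R :=
  a * (- exp (- (a * x)) + W * g1 (a * x)).

Section KernelCoefficients.
Variables (g g1 : R -> R).
Hypothesis Hg : forall x, is_derive g x (g1 x).
Hypothesis Hg1 : forall x, is_derive g1 x (g x).

Lemma is_derive_kernel (W a x : R) : is_derive (kernel W a g) x (kernel1 W a g1 x).
Proof.
  unfold kernel, kernel1.
  apply (is_derive_ext (fun x => exp (- (a * x)) + W * g (a * x))); auto.
  auto_derive.
  - eexists; apply Hg.
  - rewrite (is_derive_unique (fun y : R => g y) _ _ (Hg _)); ring.
Qed.

Lemma is_derive_kernel1 (W a x : R) :
  is_derive (kernel1 W a g1) x (a ^ 2 * kernel W a g x).
Proof.
  unfold kernel, kernel1.
  auto_derive.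
  - eexists; apply Hg1.
  - rewrite (is_derive_unique (fun y : R => g1 y) _ _ (Hg1 _)); ring.
Qed.

Lemma continuous_kernel (W a x : R) : continuous (kernel W a g) x.
Proof. apply (ex_derive_continuous (kernel W a g)); eexists; apply is_derive_kernel. Qed.

(** In the Wronskian formula the last hypothesis removes the boundary term at [PI]. At [0],
    [g1 0 = 0] makes the slope of the kernel equal to [- a] for any [W], and this alone gives the
    numerator. *)
Lemma kernel_cos_coefficient (W a k : R) :
  a <> 0 -> g1 0 = 0 ->
  kernel1 W a g1 PI * cos (k * PI) + k * kernel W a g PI * sin (k * PI) = 0 ->
  is_RInt (fun x => kernel W a g x * cos (k * x)) 0 PI (a / (a ^ 2 + k ^ 2)).
Proof.
  intros Ha H0 Hb.
  assert (P : 0 < a ^ 2 + k ^ 2) by (pose proof (pow2_gt_0 a Ha); pose proof (pow2_ge_0 k); lra).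
  assert (N : a ^ 2 <> - k ^ 2) by lra.
  pose proof (is_RInt_ode _ _ _ _ _ _ 0 PI N (is_derive_kernel W a) (is_derive_kernel1 W a)
    (is_derive_cos_freq k) (is_derive_cos_freq2 k)) as H; cbv beta in H.
  match type of H with is_RInt _ _ _ ?l =>
    replace l with (a / (a ^ 2 + k ^ 2)) in H; [exact H|] end.
  rewrite !Rmult_0_r, sin_0, cos_0.
  replace (kernel1 W a g1 0) with (- a)
    by (unfold kernel1; rewrite Rmult_0_r, H0, Ropp_0, exp_0; ring).
  replace (kernel1 W a g1 PI * cos (k * PI)) with (- (k * kernel W a g PI * sin (k * PI))) by lra.
  field; lra.
Qed.

(** Companion for odd [g]: the value of the kernel at [0] is [1] for any [W], and the surviving
    boundary term is [k] times that value. *)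
Lemma kernel_sin_coefficient (W a k : R) :
  a <> 0 -> g 0 = 0 ->
  kernel1 W a g1 PI * sin (k * PI) - k * kernel W a g PI * cos (k * PI) = 0 ->
  is_RInt (fun x => kernel W a g x * sin (k * x)) 0 PI (k / (a ^ 2 + k ^ 2)).
Proof.
  intros Ha H0 Hb.
  assert (P : 0 < a ^ 2 + k ^ 2) by (pose proof (pow2_gt_0 a Ha); pose proof (pow2_ge_0 k); lra).
  assert (N : a ^ 2 <> - k ^ 2) by lra.
  pose proof (is_RInt_ode _ _ _ _ _ _ 0 PI N (is_derive_kernel W a) (is_derive_kernel1 W a)
    (is_derive_sin_freq k) (is_derive_sin_freq2 k)) as H; cbv beta in H.
  match type of H with is_RInt _ _ _ ?l =>
    replace l with (k / (a ^ 2 + k ^ 2)) in H; [exact H|] end.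
  rewrite !Rmult_0_r, sin_0, cos_0.
  replace (kernel W a g 0) with 1
    by (unfold kernel; rewrite Rmult_0_r, H0, Ropp_0, exp_0; ring).
  replace (kernel1 W a g1 PI * sin (k * PI)) with (k * kernel W a g PI * cos (k * PI)) by lra.
  field; lra.
Qed.

End KernelCoefficients.

Lemma image_weight_mul (h : R -> R) (t : R) : h t <> 0 -> image_weight h t * h t = exp (- t).
Proof. intros H; unfold image_weight; field; auto. Qed.

(** The weight makes the derivative of the kernel vanish at [PI], and the other boundary term
    contains [sin (k * PI) = 0]. In the three variants below, likewise, the weight cancels the value
    or the slope at [PI] and the condition on [k] cancels the other. *)
Lemma kernel_cosh_sinh_cos (a k : R) :
  0 < a -> sin (k * PI) = 0 ->
  is_RInt (fun x => kernel (image_weight sinh (a * PI)) a cosh x * cos (k * x)) 0 PI (a / (a ^ 2 + k ^ 2)).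
Proof.
  intros Ha Hk; pose proof PI_RGT_0.
  apply kernel_cos_coefficient with sinh; auto using is_derive_cosh, is_derive_sinh, sinh_0; [lra|].
  unfold kernel1; rewrite image_weight_mul, Hk; [ring|].
  apply Rgt_not_eq, sinh_pos, Rmult_lt_0_compat; auto.
Qed.

Lemma kernel_sinh_cosh_cos (a k : R) :
  0 < a -> cos (k * PI) = 0 ->
  is_RInt (fun x => kernel (- image_weight cosh (a * PI)) a cosh x * cos (k * x)) 0 PI (a / (a ^ 2 + k ^ 2)).
Proof.
  intros Ha Hk; pose proof PI_RGT_0.
  apply kernel_cos_coefficient with sinh; auto using is_derive_cosh, is_derive_sinh, sinh_0; [lra|].
  unfold kernel; rewrite <- Ropp_mult_distr_l, image_weight_mul, Hk; [ring|].
  apply Rgt_not_eq, cosh_pos.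
Qed.

Lemma kernel_sinh_sinh_sin (a k : R) :
  0 < a -> sin (k * PI) = 0 ->
  is_RInt (fun x => kernel (- image_weight sinh (a * PI)) a sinh x * sin (k * x)) 0 PI (k / (a ^ 2 + k ^ 2)).
Proof.
  intros Ha Hk; pose proof PI_RGT_0.
  apply kernel_sin_coefficient with cosh; auto using is_derive_cosh, is_derive_sinh, sinh_0; [lra|].
  unfold kernel; rewrite <- Ropp_mult_distr_l, image_weight_mul, Hk; [ring|].
  apply Rgt_not_eq, sinh_pos, Rmult_lt_0_compat; auto.
Qed.

Lemma kernel_cosh_cosh_sin (a k : R) :
  0 < a -> cos (k * PI) = 0 ->
  is_RInt (fun x => kernel (image_weight cosh (a * PI)) a sinh x * sin (k * x)) 0 PI (k / (a ^ 2 + k ^ 2)).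
Proof.
  intros Ha Hk; pose proof PI_RGT_0.
  apply kernel_sin_coefficient with cosh; auto using is_derive_cosh, is_derive_sinh, sinh_0; [lra|].
  unfold kernel1; rewrite image_weight_mul, Hk; [ring|].
  apply Rgt_not_eq, cosh_pos.
Qed.

(** * Partial fractions *)

Lemma fourier_expansion_fun (phi : nat -> R -> R) (m : nat -> R) (f : R -> R) (c : nat -> R) :
  fourier_basis phi m -> (forall x, continuous f x) ->
  (forall k, is_RInt (fun x => f x * phi k x) 0 PI (m k * c k)) ->
  ex_series (fun k => Rabs (c k)) ->
  forall x, 0 <= x <= PI -> is_series (fun k => c k * phi k x) (f x).
Proof.
  intros Hb Cf Hf Hc x Hx.
  (* The general theorem is used with an empty series, [Q = 0], and correction [P = - f]. *)
  replace (f x) with (0 - (-1 * f x + 0 * f x)) by ring.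
  apply (fourier_expansion phi m (fun _ _ => 0) (fun _ => 0) (fun x => -1 * f x + 0 * f x) c
    (fun k => -1 * (m k * c k) + 0 * (m k * c k)) (fun _ _ => 0) (fun _ => 0)); auto.
  - intros; apply continuous_const.
  - intros y; now apply continuous_lincomb.
  - apply is_lim_seq_const.
  - intros N y _; right.
    rewrite sum_n_const, Rmult_0_r, Rminus_0_r; apply Rabs_R0.
  - intros n k; apply is_RInt_zero; intros; ring.
  - intros k; apply is_RInt_eq_ext with (2 := is_RInt_lincomb _ _ _ _ (-1) 0 _ _ (Hf k) (Hf k)).
    intros; ring.
  - intros k; replace (m k * c k + (-1 * (m k * c k) + 0 * (m k * c k))) with 0 by ring.
    change (is_lim_seq (sum_n (fun _ => 0)) 0).
    apply is_lim_seq_ext with (fun _ => 0); [|apply is_lim_seq_const].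
    intros n; rewrite sum_n_const; simpl; ring.
Qed.

(** Comparison with the telescoping series of [2 / ((n + 1) (n + 2))], whose sum is [2]. *)
Lemma ex_series_inv_sqr : ex_series (fun n => / INR (S n) ^ 2).
Proof.
  apply ex_series_dominated with (fun n => 2 * (/ INR (S n) - / INR (S (S n)))).
  - intros n; pose proof (pos_INR n); rewrite !S_INR.
    rewrite Rabs_right by (left; apply Rinv_0_lt_compat, pow_lt; lra).
    replace (2 * (/ (INR n + 1) - / (INR n + 1 + 1)))
      with (2 / ((INR n + 1) * (INR n + 1 + 1))) by (field; lra).
    apply Rmult_le_reg_r with ((INR n + 1) ^ 2 * (INR n + 2)).
    + apply Rmult_lt_0_compat; [apply pow_lt|]; lra.
    + replace (/ (INR n + 1) ^ 2 * ((INR n + 1) ^ 2 * (INR n + 2))) with (INR n + 2) by (field; lra).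
      replace (2 / ((INR n + 1) * (INR n + 1 + 1)) * ((INR n + 1) ^ 2 * (INR n + 2)))
        with (2 * (INR n + 1)) by (field; lra).
      lra.
  - exists 2.
    assert (L : is_lim_seq (fun n => 2 - 2 * / INR (S (S n))) (2 - 2 * 0)).
    { apply is_lim_seq_minus'; [apply is_lim_seq_const|].
      apply (is_lim_seq_scal_l _ 2 0).
      apply (is_lim_seq_incr_1 (fun n => / INR (S n))), (is_lim_seq_incr_1 (fun n => / INR n)).
      apply (is_lim_seq_inv INR p_infty); [apply is_lim_seq_INR|discriminate]. }
    replace (2 - 2 * 0) with 2 in L by ring.
    change (is_lim_seq (sum_n (fun n => 2 * (/ INR (S n) - / INR (S (S n))))) 2).
    refine (is_lim_seq_ext _ _ _ _ L); intros n.
    induction n as [|n IH].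
    + rewrite sum_O; simpl; field.
    + rewrite sum_n_Rplus, <- IH.
      pose proof (pos_INR n); rewrite !S_INR; field; lra.
Qed.

Lemma ex_series_le_inv_sqr (C : R) (c : nat -> R) :
  (forall n, Rabs (c n) <= C * / INR (S n) ^ 2) -> ex_series (fun n => Rabs (c n)).
Proof.
  intros H; apply ex_series_dominated with (fun n => C * / INR (S n) ^ 2).
  - intros n; rewrite Rabs_Rabsolu; apply H.
  - apply (ex_series_scal C (fun n => / INR (S n) ^ 2)), ex_series_inv_sqr.
Qed.

(* The cosine basis contains the constant function at index [0], whose coefficient is
   always normalised to [0] below. *)
Definition from1 (c : nat -> R) (k : nat) : R := match k with O => 0 | S j => c j end.

Lemma ex_series_from1 (c : nat -> R) :
  ex_series (fun k => Rabs (c k)) -> ex_series (fun k => Rabs (from1 c k)).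
Proof. intros H; apply ex_series_incr_1; exact H. Qed.

Lemma is_series_from1 (c u : nat -> R) (l : R) :
  is_series (fun k => from1 c k * u k) l -> is_series (fun k => c k * u (S k)) l.
Proof.
  intros H; apply (is_series_incr_1 (fun k => from1 c k * u k)).
  change (is_series (fun k => from1 c k * u k) (l + from1 c 0 * u 0%nat)).
  simpl from1 at 2; now rewrite Rmult_0_l, Rplus_0_r.
Qed.

Lemma is_RInt_one_cos (k : R) :
  k <> 0 -> sin (k * PI) = 0 -> is_RInt (fun x => cos (k * x)) 0 PI 0.
Proof.
  intros Hk Hs.
  enough (H : is_RInt (fun x => cos (k * x)) 0 PI (sin (k * PI) / k - sin (k * 0) / k)).
  { revert H; rewrite Hs, Rmult_0_r, sin_0.
    now replace (0 / k - 0 / k) with 0 by (field; auto). }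
  apply (is_RInt_antiderivative (fun x => sin (k * x) / k)).
  - intros x; auto_derive; auto; field; auto.
  - intros; apply continuous_cos_freq.
Qed.

Lemma is_RInt_one_sin (k : R) :
  k <> 0 -> cos (k * PI) = 0 -> is_RInt (fun x => sin (k * x)) 0 PI (/ k).
Proof.
  intros Hk Hs.
  replace (/ k) with (- cos (k * PI) / k - - cos (k * 0) / k)
    by (rewrite Hs, Rmult_0_r, cos_0; field; auto).
  apply (is_RInt_antiderivative (fun x => - cos (k * x) / k)).
  - intros x; auto_derive; auto; field; auto.
  - intros; apply continuous_sin_freq.
Qed.

(** This is [PI^2 * B_2 (x / (2 PI))] for the second Bernoulli polynomial [B_2], the sum of
    [cos (n x) / n^2] on [[0, PI]]. It yields [zeta 2] at [x = 0], the alternating sum at [x = PI],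
    and later the polynomial part of the first formula. *)
Definition bern2 (x : R) : R := x ^ 2 / 4 - PI * x / 2 + PI ^ 2 / 6.

Lemma continuous_bern2 (x : R) : continuous bern2 x.
Proof. apply (ex_derive_continuous bern2); unfold bern2; auto_derive; auto. Qed.

Lemma is_RInt_bern2_cos (k : R) :
  k <> 0 -> sin (k * PI) = 0 ->
  is_RInt (fun x => bern2 x * cos (k * x)) 0 PI (PI / 2 * / k ^ 2).
Proof.
  intros Hk Hs.
  pose (F := fun x => bern2 x * sin (k * x) / k + (x / 2 - PI / 2) * cos (k * x) / k ^ 2
                      - sin (k * x) / (2 * k ^ 3)).
  replace (PI / 2 * / k ^ 2) with (F PI - F 0)
    by (unfold F; rewrite Hs, (Rmult_0_r k), sin_0, cos_0; field; auto).
  apply is_RInt_antiderivative.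
  - intros x; unfold F, bern2; auto_derive; auto; field; auto.
  - intros x; apply continuous_Rmult; [apply continuous_bern2|apply continuous_cos_freq].
Qed.

Lemma is_RInt_bern2 : is_RInt bern2 0 PI 0.
Proof.
  pose (F := fun x => x ^ 3 / 12 - PI * x ^ 2 / 4 + PI ^ 2 * x / 6).
  enough (H : is_RInt bern2 0 PI (F PI - F 0)).
  { now replace (F PI - F 0) with 0 in H by (unfold F; field). }
  apply is_RInt_antiderivative.
  - intros x; unfold F, bern2; auto_derive; auto; field.
  - apply continuous_bern2.
Qed.

Lemma is_series_bern2 (x : R) : 0 <= x <= PI ->
  is_series (fun k => / INR (S k) ^ 2 * cos (INR (S k) * x)) (bern2 x).
Proof.
  intros Hx; apply (is_series_from1 (fun k => / INR (S k) ^ 2) (fun k => cos (INR k * x))).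
  apply (fourier_expansion_fun (fun k x => cos (INR k * x)) cos_int_norm bern2); auto.
  - apply basis_cos_int.
  - apply continuous_bern2.
  - intros [|k]; unfold cos_int_norm, from1.
    + rewrite Rmult_0_r; apply is_RInt_eq_ext with (2 := is_RInt_bern2).
      intros y; simpl; rewrite Rmult_0_l, cos_0; ring.
    + apply is_RInt_bern2_cos; [apply not_0_INR; lia|apply cos_sin_INR_PI].
  - apply ex_series_from1, ex_series_le_inv_sqr with 1; intros n.
    rewrite Rabs_right; [lra|]; left; apply Rinv_0_lt_compat, pow_lt, lt_0_INR; lia.
Qed.

Lemma zeta_2 : zeta 2 = PI ^ 2 / 6.
Proof.
  pose proof PI_RGT_0.
  assert (H0 : 0 <= 0 <= PI) by lra.
  replace (PI ^ 2 / 6) with (bern2 0) by (unfold bern2; field).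
  rewrite <- (is_series_unique _ _ (is_series_bern2 0 H0)).
  unfold zeta; apply Series_ext; intros k.
  assert (0 < INR (S k)) by (apply lt_0_INR; lia).
  rewrite Rmult_0_r, cos_0, Rmult_1_r, Rpower_Ropp; f_equal.
  rewrite <- Rpower_pow by assumption; f_equal.
Qed.

Lemma is_series_ext_R (a b : nat -> R) (l : R) :
  (forall n, a n = b n) -> is_series a l -> is_series b l.
Proof. intros E; now apply is_series_ext. Qed.

Lemma is_series_scal_R (c : R) (a : nat -> R) (l : R) :
  is_series a l -> is_series (fun n => c * a n) (c * l).
Proof. exact (is_series_scal c a l). Qed.

Lemma eta_2 : is_series (fun n => (-1) ^ n / INR (S n) ^ 2) (PI ^ 2 / 12).
Proof.
  pose proof PI_RGT_0.
  assert (H0 : 0 <= PI <= PI) by lra.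
  replace (PI ^ 2 / 12) with ((-1) * bern2 PI) by (unfold bern2; field).
  apply is_series_ext_R with (2 := is_series_scal_R (-1) _ _ (is_series_bern2 PI H0)).
  intros k; rewrite (proj1 (cos_sin_INR_PI _)); simpl ((-1) ^ S k); unfold Rdiv; ring.
Qed.

(** Value at [x = PI] of the cosine series of [cosh (xi (PI - x)) / sinh (xi PI)]: there
    [cos (n PI)] produces the alternating signs and the kernel equals [1 / sinh (xi PI)]. *)
Lemma mittag_leffler_sinh (xi : R) : 0 < xi ->
  is_series (fun n => (-1) ^ n / (INR (S n) ^ 2 + xi ^ 2))
            ((1 - PI * xi / sinh (PI * xi)) / (2 * xi ^ 2)).
Proof.
  intros Hxi; pose proof PI_RGT_0.
  assert (Hs : 0 < sinh (xi * PI)) by (apply sinh_pos, Rmult_lt_0_compat; auto).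
  pose (K := kernel (image_weight sinh (xi * PI)) xi cosh).
  (* The subtracted constant cancels the mean of the kernel, so that the coefficient at index [0]
     vanishes. *)
  pose (f := fun x => (PI / (2 * xi)) * K x + (- / (2 * xi ^ 2)) * 1).
  pose (c := fun k => / (INR (S k) ^ 2 + xi ^ 2)).
  assert (Pk : forall k, 0 < INR k ^ 2 + xi ^ 2)
    by (intros k; pose proof (pow2_ge_0 (INR k)); pose proof (pow_lt xi 2 Hxi); lra).
  assert (Hf : is_series (fun k => from1 c k * cos (INR k * PI)) (f PI)).
  { apply (fourier_expansion_fun (fun k x => cos (INR k * x)) cos_int_norm f); auto; try lra.
    - apply basis_cos_int.
    - intros x; apply continuous_lincomb; [|apply continuous_const].
      apply continuous_kernel with sinh; apply is_derive_cosh.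
    - intros k.
      pose proof (kernel_cosh_sinh_cos xi (INR k) Hxi (proj2 (cos_sin_INR_PI k))) as HK.
      specialize (Pk k); destruct k as [|k]; unfold cos_int_norm, from1.
      + replace (PI * 0) with (PI / (2 * xi) * (xi / (xi ^ 2 + INR 0 ^ 2)) + (- / (2 * xi ^ 2)) * PI)
          by (simpl; field; lra).
        apply is_RInt_eq_ext with (2 := is_RInt_lincomb _ _ _ _ (PI / (2 * xi)) (- / (2 * xi ^ 2))
          _ _ HK is_RInt_one).
        intros x; unfold f, K; simpl; rewrite Rmult_0_l, cos_0; ring.
      + assert (Hn : INR (S k) <> 0) by (apply not_0_INR; lia).
        pose proof (is_RInt_one_cos _ Hn (proj2 (cos_sin_INR_PI (S k)))) as H1.
        replace (PI / 2 * c k) with (PI / (2 * xi) * (xi / (xi ^ 2 + INR (S k) ^ 2)) + (- / (2 * xi ^ 2)) * 0)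
          by (unfold c; field; lra).
        apply is_RInt_eq_ext with (2 := is_RInt_lincomb _ _ _ _ (PI / (2 * xi)) (- / (2 * xi ^ 2)) _ _ HK H1).
        intros x; unfold f, K; ring.
    - apply ex_series_from1, ex_series_le_inv_sqr with 1; intros n; unfold c.
      assert (0 < INR (S n)) by (apply lt_0_INR; lia).
      specialize (Pk (S n)).
      rewrite Rabs_right by (left; apply Rinv_0_lt_compat; lra).
      rewrite Rmult_1_l; apply Rinv_le_contravar; [apply pow_lt; auto|].
      pose proof (pow_lt xi 2 Hxi); lra. }
  apply is_series_from1 in Hf.
  replace ((1 - PI * xi / sinh (PI * xi)) / (2 * xi ^ 2)) with ((-1) * f PI).
  - apply is_series_ext_R with (2 := is_series_scal_R (-1) _ _ Hf).
    intros n; rewrite (proj1 (cos_sin_INR_PI _)); unfold c; simpl ((-1) ^ S n).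
    field; specialize (Pk (S n)); lra.
  - assert (E : K PI = / sinh (xi * PI)).
    { unfold K, kernel, image_weight.
      apply Rmult_eq_reg_r with (sinh (xi * PI)); [|lra].
      rewrite Rinv_l by lra.
      replace ((exp (- (xi * PI)) + exp (- (xi * PI)) / sinh (xi * PI) * cosh (xi * PI)) * sinh (xi * PI))
        with (exp (- (xi * PI)) * (cosh (xi * PI) + sinh (xi * PI))) by (field; lra).
      rewrite cosh_plus_sinh, <- exp_plus, Rplus_opp_l; apply exp_0. }
    unfold f; rewrite E, (Rmult_comm PI xi); field; lra.
Qed.

(** Value at [x = PI] of the half-integer sine series of [1 - cosh (xi (PI - x)) / cosh (xi PI)], up
    to a factor. This function vanishes at [0], which gives the coefficients the cubic decay needed
    for absolute convergence. *)
Lemma mittag_leffler_cosh (xi : R) : 0 < xi ->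
  is_series (fun n => (-1) ^ n / (half_odd (S n) * (half_odd (S n) ^ 2 + xi ^ 2)))
            (PI / (2 * xi ^ 2) * (1 - / cosh (PI * xi))).
Proof.
  intros Hxi; pose proof PI_RGT_0.
  assert (Hs : 0 < cosh (xi * PI)) by apply cosh_pos.
  pose (K := kernel (image_weight cosh (xi * PI)) xi sinh).
  pose (f := fun x => (- (PI / (2 * xi ^ 2))) * K x + (PI / (2 * xi ^ 2)) * 1).
  pose (c := fun k => / (half_odd (S k) * (half_odd (S k) ^ 2 + xi ^ 2))).
  assert (Pk : forall k, 0 < half_odd k ^ 2 + xi ^ 2)
    by (intros k; pose proof (pow2_ge_0 (half_odd k)); pose proof (pow_lt xi 2 Hxi); lra).
  assert (Hf : is_series (fun k => c k * sin (half_odd (S k) * PI)) (f PI)).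
  { apply (fourier_expansion_fun (fun k x => sin (half_odd (S k) * x)) (fun _ => PI / 2) f); auto; try lra.
    - apply basis_sin_half.
    - intros x; apply continuous_lincomb; [|apply continuous_const].
      apply continuous_kernel with cosh; apply is_derive_sinh.
    - intros k.
      pose proof (half_odd_S_ge k) as Hn.
      pose proof (kernel_cosh_cosh_sin xi _ Hxi (proj1 (cos_sin_half_PI k))) as HK.
      specialize (Pk (S k)).
      assert (Hn0 : half_odd (S k) <> 0) by lra.
      pose proof (is_RInt_one_sin _ Hn0 (proj1 (cos_sin_half_PI k))) as H1.
      replace (PI / 2 * c k) with ((- (PI / (2 * xi ^ 2))) * (half_odd (S k) / (xi ^ 2 + half_odd (S k) ^ 2))
         + (PI / (2 * xi ^ 2)) * / half_odd (S k))
        by (unfold c; field; lra).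
      apply is_RInt_eq_ext with (2 := is_RInt_lincomb _ _ _ _ (- (PI / (2 * xi ^ 2))) (PI / (2 * xi ^ 2))
        _ _ HK H1).
      intros x; unfold f, K; ring.
    (* The constant comes from [half_odd (S n) >= 1 / 2] and [half_odd (S n) >= INR (S n) / 2]. *)
    - apply ex_series_le_inv_sqr with 8; intros n; unfold c.
      pose proof (half_odd_S_ge n) as Hn.
      specialize (Pk (S n)).
      rewrite Rabs_right by (left; apply Rinv_0_lt_compat, Rmult_lt_0_compat; lra).
      assert (0 < INR (S n)) by (apply lt_0_INR; lia).
      replace (8 * / INR (S n) ^ 2) with (/ (/ 2 * (INR (S n) / 2) ^ 2)) by (field; lra).
      apply Rinv_le_contravar; [apply Rmult_lt_0_compat; [lra|apply pow_lt; lra]|].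
      pose proof (pow_lt xi 2 Hxi).
      apply Rmult_le_compat; try lra; [apply pow_le; lra|].
      apply Rle_trans with (half_odd (S n) ^ 2); [|lra].
      apply pow_incr; split; [lra|]; rewrite half_odd_S, S_INR; pose proof (pos_INR n); lra. }
  replace (PI / (2 * xi ^ 2) * (1 - / cosh (PI * xi))) with (f PI).
  - apply is_series_ext_R with (2 := Hf).
    intros n; rewrite (proj2 (cos_sin_half_PI _)); unfold c, Rdiv; ring.
  - assert (E : K PI = / cosh (xi * PI)).
    { unfold K, kernel, image_weight.
      apply Rmult_eq_reg_r with (cosh (xi * PI)); [|lra].
      rewrite Rinv_l by lra.
      replace ((exp (- (xi * PI)) + exp (- (xi * PI)) / cosh (xi * PI) * sinh (xi * PI)) * cosh (xi * PI))
        with (exp (- (xi * PI)) * (cosh (xi * PI) + sinh (xi * PI))) by (field; lra).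
      rewrite cosh_plus_sinh, <- exp_plus, Rplus_opp_l; apply exp_0. }
    unfold f; rewrite E, (Rmult_comm PI xi); field; lra.
Qed.

(** * Expansion of the periodised function *)

Lemma ex_series_exp_neg (C : R) : ex_series (fun n => C * exp (- INR n)).
Proof.
  apply (ex_series_scal C (fun n => exp (- INR n))).
  apply ex_series_ext with (fun n => exp (- (1)) ^ n).
  - intros n; induction n as [|n IH].
    + simpl; now rewrite Ropp_0, exp_0.
    + simpl pow; rewrite IH, S_INR, <- exp_plus; f_equal; ring.
  - apply ex_series_geom.
    rewrite Rabs_right by (left; apply exp_pos).
    pose proof (exp_increasing (- (1)) 0) as H; rewrite exp_0 in H; apply H; lra.
Qed.

(** * Exponential bounds for the hyperbolic functions and the image terms *)

Lemma exp_le (x y : R) : x <= y -> exp x <= exp y.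
Proof. intros [H| ->]; [left; now apply exp_increasing|right; reflexivity]. Qed.

Lemma PI_gt_3 : 3 < PI.
Proof. pose proof PI2_3_2; lra. Qed.

(** One lower bound shared by [sinh] and [cosh]. It starts at [t = 1] since [sinh] vanishes at [0];
    the arguments met below stay above [1] because frequencies are at least [1 / 2], [PI > 3] and
    [beta] is confined to a neighbourhood of [1]. *)
Definition exp_growing (h : R -> R) : Prop := forall t, 1 <= t -> exp t / 4 <= h t.

Definition exp_bounded (g : R -> R) : Prop := forall t, 0 <= t -> Rabs (g t) <= exp t.

Lemma exp_growing_sinh : exp_growing sinh.
Proof.
  intros t Ht; unfold sinh.
  pose proof (exp_ineq1_le t).
  assert (exp (- t) <= 1) by (rewrite <- exp_0; apply exp_le; lra).
  lra.
Qed.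

Lemma exp_growing_cosh : exp_growing cosh.
Proof. intros t Ht; unfold cosh; pose proof (exp_pos t); pose proof (exp_pos (- t)); lra. Qed.

Lemma exp_bounded_sinh : exp_bounded sinh.
Proof.
  intros t Ht; unfold sinh; pose proof (exp_pos t); pose proof (exp_pos (- t)).
  assert (exp (- t) <= exp t) by (apply exp_le; lra).
  apply Rabs_le; lra.
Qed.

Lemma exp_bounded_cosh : exp_bounded cosh.
Proof.
  intros t Ht; unfold cosh; pose proof (exp_pos t); pose proof (exp_pos (- t)).
  assert (exp (- t) <= exp t) by (apply exp_le; lra).
  apply Rabs_le; lra.
Qed.

Lemma exp_growing_pos (h : R -> R) (t : R) : exp_growing h -> 1 <= t -> 0 < h t.
Proof. intros H Ht; specialize (H t Ht); pose proof (exp_pos t); lra. Qed.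

Lemma exp_growing_inv (h : R -> R) (t : R) :
  exp_growing h -> 1 <= t -> 0 < / h t <= 4 * exp (- t).
Proof.
  intros H Ht; pose proof (exp_growing_pos h t H Ht); specialize (H t Ht).
  split; [now apply Rinv_0_lt_compat|].
  rewrite exp_Ropp; replace (4 * / exp t) with (/ (exp t / 4))
    by (field; apply Rgt_not_eq, exp_pos).
  apply Rinv_le_contravar; auto; pose proof (exp_pos t); lra.
Qed.

Lemma Rabs_m1_pow (n : nat) : Rabs ((-1) ^ n) = 1.
Proof. rewrite <- RPow_abs, Rabs_m1; apply pow1. Qed.

Definition image_term (h g : R -> R) (nu : nat -> R) (beta s : R) (n : nat) : R :=
  (-1) ^ n / nu n * (image_weight h (nu n * beta * PI) * g (nu n * s)).

(** With [t = nu n * beta * PI], the factors [exp (- t)], [1 / h t <= 4 exp (- t)] and [g <= exp t]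
    leave [4 exp (- t)], and [1 / nu n <= 2] gives [8]. The bound on [g] is where [s <= beta * PI]
    enters; [t >= 9/4 * nu n] makes the result independent of [beta]. *)
Lemma image_term_bound (h g : R -> R) (nu : nat -> R) (beta s : R) (n : nat) :
  exp_growing h -> exp_bounded g -> INR n + / 2 <= nu n ->
  3 / 4 < beta -> 0 <= s <= beta * PI ->
  Rabs (image_term h g nu beta s n) <= 8 * exp (- INR n).
Proof.
  intros Hh Hg Hnu Hb Hs; unfold image_term; pose proof PI_gt_3; pose proof (pos_INR n).
  set (v := nu n) in *; set (t := v * beta * PI).
  assert (9 / 4 <= beta * PI) by nra.
  assert (Ht : 9 / 4 * v <= t) by (unfold t; rewrite Rmult_assoc; nra).
  assert (Ht1 : 1 <= t) by lra.
  assert (Hvs : 0 <= v * s <= t) by (unfold t; rewrite Rmult_assoc; split; nra).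
  destruct (exp_growing_inv h t Hh Ht1) as [I1 I2].
  specialize (Hg (v * s) (proj1 Hvs)).
  assert (Hg' : Rabs (g (v * s)) <= exp t) by (apply Rle_trans with (1 := Hg); apply exp_le; lra).
  assert (E : exp (- t) * exp t = 1) by (rewrite <- exp_plus, Rplus_opp_l; apply exp_0).
  pose proof (exp_pos (- t)) as e1; pose proof (exp_pos t) as e2.
  unfold Rdiv at 1; rewrite !Rabs_mult, Rabs_m1_pow, Rmult_1_l.
  assert (Hv : Rabs (/ v) <= 2).
  { rewrite Rabs_right by (left; apply Rinv_0_lt_compat; lra).
    replace 2 with (/ / 2) by field; apply Rinv_le_contravar; lra. }
  assert (HW : Rabs (image_weight h t) * Rabs (g (v * s)) <= 4 * exp (- t)).
  { unfold image_weight, Rdiv; rewrite Rabs_right by (left; apply Rmult_lt_0_compat; auto).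
    apply Rle_trans with (exp (- t) * (4 * exp (- t)) * exp t).
    - apply Rmult_le_compat; auto using Rabs_pos.
      + left; apply Rmult_lt_0_compat; auto.
      + apply Rmult_le_compat_l; lra.
    - replace (exp (- t) * (4 * exp (- t)) * exp t) with (4 * exp (- t) * (exp (- t) * exp t)) by ring.
      rewrite E; lra. }
  apply Rle_trans with (2 * (4 * exp (- t))).
  - apply Rmult_le_compat; auto using Rabs_pos.
    apply Rmult_le_pos; apply Rabs_pos.
  - assert (exp (- t) <= exp (- INR n)) by (apply exp_le; lra); lra.
Qed.

Definition alt_sum (nu : nat -> R) (s : R) : R :=
  Series (fun n => (-1) ^ n / nu n * exp (- (nu n * s))).

Lemma is_lim_seq_inv_INR_half : is_lim_seq (fun n => / (INR n + / 2)) 0.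
Proof.
  apply (is_lim_seq_inv (fun n => INR n + / 2) p_infty); [|discriminate].
  apply (is_lim_seq_plus INR (fun _ => / 2) p_infty (/ 2)).
  - apply is_lim_seq_INR.
  - apply is_lim_seq_const.
  - reflexivity.
Qed.

(** Leibniz's bound for alternating series, uniform in [s >= 0] and valid at [s = 0], where absolute
    convergence fails. Along the way it shows that [alt_sum nu s] is a true sum and not the default
    value of [Series]. *)
Lemma alt_sum_tail (nu : nat -> R) (s : R) (N : nat) :
  (forall n, INR n + / 2 <= nu n) -> (forall n, nu n <= nu (S n)) -> 0 <= s ->
  Rabs (sum_n (fun n => (-1) ^ n / nu n * exp (- (nu n * s))) N - alt_sum nu s)
    <= / (INR N + / 2).
Proof.
  intros Hnu Hinc Hs.
  pose (f := fun n => exp (- (nu n * s)) / nu n).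
  assert (Pnu : forall n, 0 < nu n) by (intros n; specialize (Hnu n); pose proof (pos_INR n); lra).
  assert (fle : forall n, 0 <= f n <= / (INR n + / 2)).
  { intros n; specialize (Hnu n); specialize (Pnu n); pose proof (pos_INR n); unfold f.
    pose proof (exp_pos (- (nu n * s))).
    assert (exp (- (nu n * s)) <= 1) by (rewrite <- exp_0; apply exp_le; nra).
    split; [left; now apply Rdiv_lt_0_compat|].
    apply Rle_trans with (1 * / nu n).
    - apply Rmult_le_compat_r; auto; left; now apply Rinv_0_lt_compat.
    - rewrite Rmult_1_l; apply Rinv_le_contravar; lra. }
  assert (Hdec : Un_decreasing f).
  { intros n; unfold f; specialize (Hinc n); pose proof (Pnu n); pose proof (Pnu (S n)).
    apply Rmult_le_compat.
    - left; apply exp_pos.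
    - left; now apply Rinv_0_lt_compat.
    - apply exp_le; nra.
    - now apply Rinv_le_contravar. }
  assert (Hlim : Un_cv f 0).
  { apply is_lim_seq_Reals.
    apply is_lim_seq_le_le with (fun _ => 0) (fun n => / (INR n + / 2)); auto.
    - apply is_lim_seq_const.
    - apply is_lim_seq_inv_INR_half. }
  destruct (alternated_series f Hdec Hlim) as [l Hl].
  assert (E : forall n, sum_n (fun n => (-1) ^ n / nu n * exp (- (nu n * s))) n
                        = sum_f_R0 (tg_alt f) n).
  { intros n; rewrite sum_n_Reals; apply sum_eq; intros i _.
    unfold tg_alt, f, Rdiv; ring. }
  assert (El : alt_sum nu s = l).
  { unfold alt_sum; apply is_series_unique.
    change (is_lim_seq (sum_n (fun n => (-1) ^ n / nu n * exp (- (nu n * s)))) l).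
    apply is_lim_seq_ext with (sum_f_R0 (tg_alt f)); [intros; now rewrite E|].
    now apply is_lim_seq_Reals. }
  rewrite E, El.
  apply Rle_trans with (f N); [|apply fle].
  exact (Alt_first_term_bound f l N N Hdec Hlim Hl (le_n N)).
Qed.

(** Common form of the four expansions. Summing the kernels with weights [(-1)^n / nu n] separates
    the sum independent of the period, [alt_sum], from the image series, and [sigma] is the sign of
    the image weight. *)
Lemma base_identity (phi : nat -> R -> R) (m c p : nat -> R) (nu : nat -> R)
  (h g g1 P : R -> R) (sigma beta : R) (J : nat -> nat -> R) :
  fourier_basis phi m -> exp_growing h -> exp_bounded g ->
  (forall x, is_derive g x (g1 x)) ->
  (forall n, INR n + / 2 <= nu n) -> (forall n, nu n <= nu (S n)) ->
  3 / 4 < beta -> (forall x, continuous P x) ->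
  (forall n k, is_RInt
     (fun x => kernel (sigma * image_weight h (nu n * beta * PI)) (nu n * beta) g x * phi k x)
     0 PI (J n k)) ->
  (forall k, is_RInt (fun x => P x * phi k x) 0 PI (p k)) ->
  (forall k, is_series (fun n => (-1) ^ n / nu n * J n k) (m k * c k + p k)) ->
  ex_series (fun k => Rabs (c k)) ->
  forall x, 0 <= x <= PI ->
  is_series (fun k => c k * phi k x)
    (alt_sum nu (beta * x) + sigma * Series (image_term h g nu beta (beta * x)) - P x).
Proof.
  intros Hb Hh Hg Dg Hnu Hinc Hbeta CP HJ Hp Hs Hc; pose proof PI_gt_3.
  assert (Himg : forall x, 0 <= x <= PI -> forall n,
    Rabs (image_term h g nu beta (beta * x) n) <= 8 * exp (- INR n)).
  { intros x Hx n; apply image_term_bound; auto; split; nra. }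
  destruct (ex_series_exp_neg 8) as [l8 Hl8].
  apply (fourier_expansion phi m
    (fun n x => (-1) ^ n / nu n * kernel (sigma * image_weight h (nu n * beta * PI)) (nu n * beta) g x)
    (fun x => alt_sum nu (beta * x) + sigma * Series (image_term h g nu beta (beta * x)))
    P c p (fun n k => (-1) ^ n / nu n * J n k)
    (* Uniform error: Leibniz's bound for [alt_sum] plus the tail of the exponential majorant of the
       image terms. *)
    (fun N => / (INR N + / 2) + Rabs sigma * (l8 - sum_n (fun n => 8 * exp (- INR n)) N))); auto.
  - intros n x; apply continuous_Rmult; [apply continuous_const|].
    apply continuous_kernel with g1; auto.
  - replace (Finite 0) with (Finite (0 + Rabs sigma * (l8 - l8))) by (f_equal; ring).
    apply is_lim_seq_plus'; [apply is_lim_seq_inv_INR_half|].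
    apply (is_lim_seq_scal_l _ (Rabs sigma) (l8 - l8)).
    apply is_lim_seq_minus'; [apply is_lim_seq_const|exact Hl8].
  - intros N x Hx.
    assert (Hx0 : 0 <= beta * x) by nra.
    pose proof (alt_sum_tail nu (beta * x) N Hnu Hinc Hx0) as T1.
    assert (Ex : ex_series (image_term h g nu beta (beta * x))).
    { apply ex_series_dominated with (fun n => 8 * exp (- INR n)); [auto|now exists l8]. }
    pose proof (sum_n_tail_le _ _ _ _ N (Himg x Hx) (Series_correct _ Ex) Hl8) as T2.
    assert (E : sum_n (fun n => (-1) ^ n / nu n *
       kernel (sigma * image_weight h (nu n * beta * PI)) (nu n * beta) g x) N =
       sum_n (fun n => (-1) ^ n / nu n * exp (- (nu n * (beta * x)))) N
       + sigma * sum_n (image_term h g nu beta (beta * x)) N :> R).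
    { induction N as [|N IH].
      - rewrite !sum_O; unfold kernel, image_term; rewrite Rmult_assoc; ring.
      - rewrite !sum_n_Rplus, IH.
        + unfold kernel, image_term; rewrite (Rmult_assoc _ beta x); ring.
        + exact (alt_sum_tail nu (beta * x) N Hnu Hinc Hx0).
        + exact (sum_n_tail_le _ _ _ _ N (Himg x Hx) (Series_correct _ Ex) Hl8). }
    rewrite E.
    set (a := sum_n (fun n => (-1) ^ n / nu n * exp (- (nu n * (beta * x)))) N) in *.
    set (b := sum_n (image_term h g nu beta (beta * x)) N) in *.
    replace (a + sigma * b - (alt_sum nu (beta * x) + sigma * Series (image_term h g nu beta (beta * x))))
      with ((a - alt_sum nu (beta * x)) + sigma * (b - Series (image_term h g nu beta (beta * x)))) by ring.
    apply Rle_trans with (1 := Rabs_triang _ _); rewrite Rabs_mult.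
    apply Rplus_le_compat; auto.
    apply Rmult_le_compat_l; auto using Rabs_pos.
  - intros n k.
    apply is_RInt_eq_ext with (2 := is_RInt_scal _ _ _ ((-1) ^ n / nu n) _ (HJ n k)).
    intros x; unfold scal; simpl; unfold mult; simpl; ring.
Qed.

(** The partial fractions of [1 / sinh] at [xi = k / beta]. The value is split into the norm
    [PI / 2] times the dual coefficient, plus [beta / (2 k^2)], the coefficient of the polynomial
    correction; [k] may be an integer or a half-integer. *)
Lemma coefficient_sum_cos (beta k : R) : 0 < beta -> 0 < k ->
  is_series (fun n => (-1) ^ n / INR (S n) *
      (INR (S n) * beta / ((INR (S n) * beta) ^ 2 + k ^ 2)))
    (PI / 2 * - / (k * sinh (PI * k / beta)) + beta / (2 * k ^ 2)).
Proof.
  intros Hb Hk; pose proof PI_gt_3.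
  assert (Hxi : 0 < k / beta) by now apply Rdiv_lt_0_compat.
  assert (Hs : 0 < sinh (PI * k / beta)).
  { apply sinh_pos; unfold Rdiv; rewrite Rmult_assoc; apply Rmult_lt_0_compat; lra. }
  replace (PI / 2 * - / (k * sinh (PI * k / beta)) + beta / (2 * k ^ 2)) with
    (/ beta * ((1 - PI * (k / beta) / sinh (PI * (k / beta))) / (2 * (k / beta) ^ 2))).
  - apply is_series_ext_R with (2 := is_series_scal_R (/ beta) _ _ (mittag_leffler_sinh _ Hxi)).
    intros n; assert (0 < INR (S n)) by (apply lt_0_INR; lia).
    field; repeat split; try lra; apply Rgt_not_eq; try nra.
  - replace (PI * (k / beta)) with (PI * k / beta) by (field; lra); field; lra.
Qed.

Lemma coefficient_sum_sin (beta k : R) : 0 < beta -> 0 < k ->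
  is_series (fun n => (-1) ^ n / half_odd (S n) *
      (k / ((half_odd (S n) * beta) ^ 2 + k ^ 2)))
    (PI / 2 * - / (k * cosh (PI * k / beta)) + PI / 2 * / k).
Proof.
  intros Hb Hk; pose proof PI_gt_3.
  assert (Hxi : 0 < k / beta) by now apply Rdiv_lt_0_compat.
  pose proof (cosh_pos (PI * k / beta)).
  replace (PI / 2 * - / (k * cosh (PI * k / beta)) + PI / 2 * / k) with
    (k / beta ^ 2 * (PI / (2 * (k / beta) ^ 2) * (1 - / cosh (PI * (k / beta))))).
  - apply is_series_ext_R with (2 := is_series_scal_R (k / beta ^ 2) _ _ (mittag_leffler_cosh _ Hxi)).
    intros n; pose proof (half_odd_S_ge n).
    field; repeat split; try lra; apply Rgt_not_eq; try nra.
  - replace (PI * (k / beta)) with (PI * k / beta) by (field; lra); field; lra.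
Qed.

Lemma dual_term_summable (h : R -> R) (kap : nat -> R) (beta : R) :
  exp_growing h -> (forall n, INR n + / 2 <= kap n) -> 3 / 4 < beta < 5 / 4 ->
  ex_series (fun n => Rabs (- / (kap n * h (PI * kap n / beta)))).
Proof.
  intros Hh Hk Hb; pose proof PI_gt_3.
  apply ex_series_dominated with (fun n => 8 * exp (- INR n)); [|apply ex_series_exp_neg].
  intros n; specialize (Hk n); pose proof (pos_INR n).
  rewrite Rabs_Rabsolu, Rabs_Ropp.
  set (t := PI * kap n / beta).
  assert (Ht : 2 * kap n <= t).
  { unfold t; apply Rmult_le_reg_r with beta; [lra|].
    unfold Rdiv; rewrite (Rmult_assoc _ (/ beta)), Rinv_l by lra; nra. }
  destruct (exp_growing_inv h t Hh) as [I1 I2]; [lra|].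
  assert (/ kap n <= 2)
    by (replace 2 with (/ / 2) by field; apply Rinv_le_contravar; lra).
  assert (0 < / kap n) by (apply Rinv_0_lt_compat; lra).
  rewrite Rinv_mult, Rabs_mult, !Rabs_right by lra.
  assert (exp (- t) <= exp (- INR n)) by (apply exp_le; lra).
  apply Rle_trans with (2 * (4 * exp (- t))); [apply Rmult_le_compat; lra|lra].
Qed.

(** * Differentiation with respect to the period *)

Lemma is_derive_sum_n (f f' : nat -> R -> R) (x : R) (N : nat) :
  (forall n, is_derive (f n) x (f' n x)) ->
  is_derive (fun y => sum_n (fun n => f n y) N) x (sum_n (fun n => f' n x) N).
Proof.
  intros H; induction N as [|N IH].
  - rewrite sum_O; apply is_derive_ext with (2 := H 0%nat); intros; now rewrite sum_O.
  - rewrite sum_Sn; apply is_derive_ext with (2 := is_derive_plus _ _ _ _ _ IH (H (S N))).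
    intros; now rewrite sum_Sn.
Qed.

Lemma difference_quotient_bound (f f' : R -> R) (x0 r h M : R) :
  (forall y, Rabs (y - x0) < r -> is_derive f y (f' y)) ->
  (forall y, Rabs (y - x0) < r -> Rabs (f' y) <= M) ->
  h <> 0 -> Rabs h < r -> Rabs ((f (x0 + h) - f x0) / h) <= M.
Proof.
  intros Hd HM Hh Hr.
  assert (Hin : forall y, Rmin x0 (x0 + h) <= y <= Rmax x0 (x0 + h) -> Rabs (y - x0) < r).
  { intros y Hy; apply Rle_lt_trans with (2 := Hr).
    unfold Rmin, Rmax in Hy; destruct (Rle_dec x0 (x0 + h)).
    - rewrite !Rabs_right; lra.
    - rewrite !Rabs_left1; lra. }
  destruct (MVT_gen f x0 (x0 + h) f') as (c & Hc & E).
  - intros y Hy; apply Hd, Hin; lra.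
  - intros y Hy; apply continuity_pt_filterlim, (ex_derive_continuous f).
    eexists; apply Hd, Hin, Hy.
  - rewrite E; replace (f' c * (x0 + h - x0) / h) with (f' c) by (field; auto).
    apply HM, Hin, Hc.
Qed.

(** By the mean value theorem the difference quotients of the terms obey the same majorant [M] as
    the derivatives, so both tails are below [e / 3] for one [N], and the finite sum is
    differentiated directly. *)
Lemma is_derive_Series (f f' : nat -> R -> R) (M : nat -> R) (x0 r : R) :
  0 < r ->
  (forall n y, Rabs (y - x0) < r -> is_derive (f n) y (f' n y)) ->
  (forall n y, Rabs (y - x0) < r -> Rabs (f' n y) <= M n) ->
  ex_series M ->
  (forall y, Rabs (y - x0) < r -> ex_series (fun n => f n y)) ->
  is_derive (fun y => Series (fun n => f n y)) x0 (Series (fun n => f' n x0)).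
Proof.
  intros Hr Hd HM [lM HsM] Hf.
  assert (Hx0 : Rabs (x0 - x0) < r) by (rewrite Rminus_diag, Rabs_R0; auto).
  apply is_derive_Reals; intros e He.
  assert (He3 : 0 < e / 3) by lra.
  assert (HT : is_lim_seq (fun N => lM - sum_n M N) 0).
  { replace (Finite 0) with (Finite (lM - lM)) by (f_equal; ring).
    apply is_lim_seq_minus'; [apply is_lim_seq_const|exact HsM]. }
  destruct (is_lim_seq_eventually_lt _ _ HT He3) as [N HN]; specialize (HN N (le_n N)).
  pose proof (is_derive_sum_n f f' x0 N (fun n => Hd n x0 Hx0)) as HdN.
  apply is_derive_Reals in HdN; destruct (HdN _ He3) as [d HdN'].
  assert (Hd0 : 0 < Rmin d r) by (apply Rmin_pos; [apply cond_pos|auto]).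
  exists (mkposreal _ Hd0); simpl; intros h Hh Hhd.
  assert (Hhd1 : Rabs h < d) by (apply Rlt_le_trans with (1 := Hhd); apply Rmin_l).
  assert (Hhr : Rabs h < r) by (apply Rlt_le_trans with (1 := Hhd); apply Rmin_r).
  specialize (HdN' h Hh Hhd1).
  pose (a := fun n => (f n (x0 + h) - f n x0) / h).
  assert (Ha : is_series a ((Series (fun n => f n (x0 + h)) - Series (fun n => f n x0)) / h)).
  { assert (Hxh : Rabs (x0 + h - x0) < r) by (now replace (x0 + h - x0) with h by ring).
    pose proof (is_series_minus _ _ _ _ (Series_correct _ (Hf _ Hxh)) (Series_correct _ (Hf _ Hx0))) as H.
    apply (is_series_scal_R (/ h)) in H.
    replace ((Series (fun n => f n (x0 + h)) - Series (fun n => f n x0)) / h) with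
      (/ h * (Series (fun n => f n (x0 + h)) - Series (fun n => f n x0))) by (unfold Rdiv; ring).
    refine (is_series_ext_R _ _ _ _ H); intros n; unfold a, Rdiv.
    rewrite Rmult_comm; reflexivity. }
  assert (Ba : forall n, Rabs (a n) <= M n).
  { intros n; apply difference_quotient_bound with (f' n) r; auto. }
  assert (Ef : ex_series (fun n => f' n x0)).
  { apply ex_series_dominated with M; [auto|now exists lM]. }
  pose proof (sum_n_tail_le _ _ _ _ N Ba Ha HsM) as T1.
  pose proof (sum_n_tail_le _ _ _ _ N (fun n => HM n x0 Hx0) (Series_correct _ Ef) HsM) as T2.
  assert (E : (sum_n (fun n => f n (x0 + h)) N - sum_n (fun n => f n x0) N) / h = sum_n a N).
  { clear; induction N as [|N IH].
    - now rewrite !sum_O.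
    - rewrite !sum_n_Rplus, <- IH; unfold a, Rdiv; ring. }
  rewrite E in HdN'.
  apply Rabs_le_between in T1; apply Rabs_le_between in T2.
  apply Rabs_def2 in HdN'; apply Rabs_def1; lra.
Qed.

Definition dual_term (phi h : R -> R) (kap : nat -> R) (theta beta : R) (k : nat) : R :=
  phi (kap k * (theta / beta)) / (kap k * h (PI * kap k / beta)).

(** The derivative at period [1] of the expansion: [PI * A] comes from the images,
    [- theta * B + PI * C] from the dual series, and [d] from the explicit polynomial. The index
    starts at [0], hence the sign [(-1) ^ S n]. *)
Definition period_identity (nu kap : nat -> R) (h g phi phi1 k k1 : R -> R)
    (sigma theta d : R) : Prop :=
  exists A B C : R,
    is_series (fun n => (-1) ^ S n * g (nu n * theta) / h (nu n * PI) ^ 2) A /\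
    is_series (fun n => phi1 (kap n * theta) / k (PI * kap n)) B /\
    is_series (fun n => phi (kap n * theta) * k1 (PI * kap n) / k (PI * kap n) ^ 2) C /\
    sigma * PI * A - theta * B + PI * C = d.

Lemma period_identity_parity (nu kap : nat -> R) (h g phi phi1 k k1 d : R -> R) (sigma e : R) :
  (forall t, g (- t) = e * g t) -> (forall t, phi (- t) = e * phi t) ->
  (forall t, phi1 (- t) = - e * phi1 t) -> (forall t, d (- t) = e * d t) ->
  (forall t, 0 <= t < PI -> period_identity nu kap h g phi phi1 k k1 sigma t (d t)) ->
  forall t, Rabs t < PI -> period_identity nu kap h g phi phi1 k k1 sigma t (d t).
Proof.
  intros Pg Pphi Pphi1 Pd H t Ht; apply Rabs_def2 in Ht.
  destruct (Rle_or_lt 0 t); [apply H; lra|].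
  destruct (H (- t)) as (A & B & C & HA & HB & HC & E); [lra|].
  assert (N : forall v, v * t = - (v * - t)) by (intros; ring).
  (* [phi1] has the parity opposite to [phi], so [B] changes by [- e], which the factor [theta]
     turns into [e]. *)
  exists (e * A), (- e * B), (e * C); repeat split.
  - apply is_series_ext_R with (2 := is_series_scal_R e _ _ HA).
    intros n; rewrite (N (nu n)), Pg; unfold Rdiv; ring.
  - apply is_series_ext_R with (2 := is_series_scal_R (- e) _ _ HB).
    intros n; rewrite (N (kap n)), Pphi1; unfold Rdiv; ring.
  - apply is_series_ext_R with (2 := is_series_scal_R e _ _ HC).
    intros n; rewrite (N (kap n)), Pphi; unfold Rdiv; ring.
  - rewrite <- (Ropp_involutive t) at 2; rewrite Pd, <- E; ring.
Qed.

Section DerivativeAtOne.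

Variables (nu kap : nat -> R) (h h1 g phi phi1 k k1 P : R -> R) (sigma theta A0 dP : R).
Hypothesis Hnu : forall n, INR n + / 2 <= nu n.
Hypothesis Hkap : forall n, INR n + / 2 <= kap n.
Hypothesis Dh : forall x, is_derive h x (h1 x).
Hypothesis Eh : forall x, h x + h1 x = exp x.
Hypothesis Gh : exp_growing h.
Hypothesis Bg : exp_bounded g.
Hypothesis Dk : forall x, is_derive k x (k1 x).
Hypothesis Gk : exp_growing k.
Hypothesis Bk1 : exp_bounded k1.
Hypothesis Dphi : forall x, is_derive phi x (phi1 x).
Hypothesis Bphi : forall x, Rabs (phi x) <= 1.
Hypothesis Bphi1 : forall x, Rabs (phi1 x) <= 1.
Hypothesis Htheta : 0 <= theta < PI.
Hypothesis Hbase : forall beta, 3 / 4 < beta < 5 / 4 -> theta <= beta * PI ->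
  is_series (dual_term phi k kap theta beta)
    (P beta - A0 - sigma * Series (image_term h g nu beta theta)).
Hypothesis HP : is_derive P 1 dP.

(** The bound [/ 4] keeps [beta] in the range of the uniform estimates, and [1 - theta / PI] keeps
    [theta <= beta * PI]. *)
Let r := Rmin (/ 4) (1 - theta / PI).

Lemma radius_pos : 0 < r.
Proof.
  pose proof PI_RGT_0; apply Rmin_pos; [lra|].
  apply Rlt_0_minus, Rmult_lt_reg_r with PI; auto.
  unfold Rdiv; rewrite Rmult_assoc, Rinv_l; lra.
Qed.

Lemma radius_spec (y : R) : Rabs (y - 1) < r -> 3 / 4 < y < 5 / 4 /\ theta <= y * PI.
Proof.
  intros H; pose proof PI_RGT_0.
  pose proof (Rmin_l (/ 4) (1 - theta / PI) : r <= _).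
  pose proof (Rmin_r (/ 4) (1 - theta / PI) : r <= _).
  apply Rabs_def2 in H; split; [lra|].
  assert (Hy : theta / PI <= y) by lra.
  apply (Rmult_le_compat_r PI) in Hy; [|lra].
  unfold Rdiv in Hy; rewrite Rmult_assoc, Rinv_l in Hy; lra.
Qed.

Definition image_deriv (n : nat) (beta : R) : R :=
  PI * ((-1) ^ S n * g (nu n * theta) / h (nu n * beta * PI) ^ 2).

Lemma scale_ge1 (v beta : R) (n : nat) :
  INR n + / 2 <= v -> 3 / 4 < beta -> 1 <= v * beta * PI.
Proof.
  intros Hv Hb; pose proof PI_gt_3; pose proof (pos_INR n).
  assert (9 / 4 <= beta * PI) by nra.
  rewrite Rmult_assoc; nra.
Qed.

Lemma is_derive_image_term (n : nat) (y : R) : Rabs (y - 1) < r ->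
  is_derive (fun beta => image_term h g nu beta theta n) y (image_deriv n y).
Proof.
  intros Hy; apply radius_spec in Hy; destruct Hy as [Hy _].
  pose proof (scale_ge1 _ y n (Hnu n)) as Ht.
  assert (Hn : nu n <> 0) by (specialize (Hnu n); pose proof (pos_INR n); lra).
  assert (H0 : 0 < h (nu n * y * PI)) by (apply exp_growing_pos; auto; lra).
  unfold image_term, image_deriv, image_weight; auto_derive.
  - repeat split; [eexists; apply Dh|lra].
  - rewrite (is_derive_unique (fun y : R => h y) _ _ (Dh _)).
    set (t := nu n * y * PI) in *.
    (* Using [h + h' = exp], the derivative of [exp (- t) / h t] collapses to [- 1 / h t ^ 2]; the
       inner derivative [nu n * PI] then cancels the [1 / nu n]. *)
    replace (exp (- t)) with (/ (h t + h1 t)) by (now rewrite Eh, exp_Ropp).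
    assert (h t + h1 t <> 0) by (rewrite Eh; apply Rgt_not_eq, exp_pos).
    simpl ((-1) ^ S n); field; repeat split; auto; lra.
Qed.

(** The squared denominator gives [exp (- 2 t)] with [2 t >= 3/2 * nu n * PI], which outweighs the
    growth [exp (nu n * theta) <= exp (nu n * PI)]. *)
Lemma image_deriv_bound (n : nat) (y : R) : Rabs (y - 1) < r ->
  Rabs (image_deriv n y) <= 16 * PI * exp (- INR n).
Proof.
  intros Hy; apply radius_spec in Hy; destruct Hy as [Hy _].
  pose proof (scale_ge1 _ y n (Hnu n)) as Ht1.
  specialize (Hnu n); pose proof (pos_INR n); pose proof PI_gt_3.
  unfold image_deriv; set (v := nu n) in *; set (t := v * y * PI) in *.
  destruct (exp_growing_inv h t Gh) as [I1 I2]; [lra|].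
  assert (Hs : 0 <= v * theta <= v * PI) by (split; nra).
  pose proof (Bg _ (proj1 Hs)) as Bg'.
  assert (Ht : 3 / 4 * (v * PI) <= t).
  { unfold t; replace (v * y * PI) with (y * (v * PI)) by ring.
    apply Rmult_le_compat_r; nra. }
  rewrite Rabs_mult, (Rabs_right PI) by lra.
  replace (16 * PI * exp (- INR n)) with (PI * (16 * exp (- INR n))) by ring.
  apply Rmult_le_compat_l; [lra|].
  unfold Rdiv; rewrite !Rabs_mult, Rabs_m1_pow, Rmult_1_l.
  rewrite <- pow_inv, (Rabs_right (_ ^ 2)) by (apply Rle_ge, pow_le; lra).
  apply Rle_trans with (exp (v * theta) * (4 * exp (- t)) ^ 2).
  - apply Rmult_le_compat; auto using Rabs_pos; [apply pow_le; lra|].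
    apply pow_incr; lra.
  - replace (exp (v * theta) * (4 * exp (- t)) ^ 2)
      with (16 * (exp (v * theta) * (exp (- t) * exp (- t)))) by ring.
    rewrite <- !exp_plus; apply Rmult_le_compat_l; [lra|]; apply exp_le.
    assert (3 * v <= v * PI) by nra; lra.
Qed.

Definition dual_deriv (n : nat) (beta : R) : R :=
  (- theta * (phi1 (kap n * (theta / beta)) / k (PI * kap n / beta))
   + PI * (phi (kap n * (theta / beta)) * k1 (PI * kap n / beta) / k (PI * kap n / beta) ^ 2))
  / beta ^ 2.

Lemma dual_scale_ge (y : R) (n : nat) :
  3 / 4 < y < 5 / 4 -> 2 * kap n <= PI * kap n / y /\ 1 <= PI * kap n / y.
Proof.
  intros Hy; pose proof PI_gt_3; pose proof (pos_INR n); specialize (Hkap n).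
  assert (H1 : 2 * kap n <= PI * kap n / y).
  { apply Rmult_le_reg_r with y; [lra|].
    unfold Rdiv; rewrite (Rmult_assoc _ (/ y)), Rinv_l by lra; nra. }
  split; lra.
Qed.

Lemma is_derive_dual_term (n : nat) (y : R) : Rabs (y - 1) < r ->
  is_derive (fun beta => dual_term phi k kap theta beta n) y (dual_deriv n y).
Proof.
  intros Hy; apply radius_spec in Hy; destruct Hy as [Hy _].
  destruct (dual_scale_ge y n Hy) as [_ Ht].
  assert (Hn : kap n <> 0) by (specialize (Hkap n); pose proof (pos_INR n); lra).
  assert (H0 : 0 < k (PI * kap n / y)) by (apply exp_growing_pos; auto; lra).
  unfold dual_term, dual_deriv; auto_derive.
  - assert (kap n * k (PI * kap n * / y) <> 0)
      by (apply Rmult_integral_contrapositive; split; [auto|unfold Rdiv in H0; lra]).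
    split; [eexists; apply Dphi|]; split; [lra|]; split; [eexists; apply Dk|].
    repeat split; [lra|assumption].
  - rewrite (is_derive_unique (fun y : R => phi y) _ _ (Dphi _)).
    rewrite (is_derive_unique (fun y : R => k y) _ _ (Dk _)).
    unfold Rdiv in *; field; repeat split; auto; lra.
Qed.

(** The two summands contribute [4 * theta] and [16 * PI], together at most [20 * PI], times
    [exp (- t)]; the factor [1 / y ^ 2 <= 2] doubles this. *)
Lemma dual_deriv_bound (n : nat) (y : R) : Rabs (y - 1) < r ->
  Rabs (dual_deriv n y) <= 40 * PI * exp (- INR n).
Proof.
  intros Hy; apply radius_spec in Hy; destruct Hy as [Hy _].
  destruct (dual_scale_ge y n Hy) as [Ht2 Ht].
  specialize (Hkap n); pose proof (pos_INR n); pose proof PI_gt_3.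
  unfold dual_deriv; set (t := PI * kap n / y) in *.
  destruct (exp_growing_inv k t Gk) as [I1 I2]; [lra|].
  pose proof (exp_pos (- t)) as e1.
  assert (E : exp (- t) * exp t = 1) by (rewrite <- exp_plus, Rplus_opp_l; apply exp_0).
  assert (H1 : Rabs (phi1 (kap n * (theta / y)) / k t) <= 4 * exp (- t)).
  { unfold Rdiv; rewrite Rabs_mult, (Rabs_right (/ k t)) by lra.
    rewrite <- (Rmult_1_l (4 * exp (- t))).
    apply Rmult_le_compat; auto using Rabs_pos; lra. }
  assert (H2 : Rabs (phi (kap n * (theta / y)) * k1 t / k t ^ 2) <= 16 * exp (- t)).
  { unfold Rdiv; rewrite !Rabs_mult, <- pow_inv, (Rabs_right (_ ^ 2))
      by (apply Rle_ge, pow_le; lra).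
    apply Rle_trans with (1 * exp t * (4 * exp (- t)) ^ 2).
    - apply Rmult_le_compat; [| |apply Rmult_le_compat|apply pow_incr]; auto using Rabs_pos; try lra.
      + apply Rmult_le_pos; apply Rabs_pos.
      + apply pow_le; lra.
      + apply Bk1; lra.
    - replace (1 * exp t * (4 * exp (- t)) ^ 2) with (16 * exp (- t) * (exp (- t) * exp t)) by ring.
      rewrite E; lra. }
  unfold Rdiv at 1; rewrite Rabs_mult.
  assert (H3 : Rabs (/ y ^ 2) <= 2).
  { rewrite Rabs_right by (left; apply Rinv_0_lt_compat, pow_lt; lra).
    replace 2 with (/ / 2) by field; apply Rinv_le_contravar; [lra|nra]. }
  assert (H4 : Rabs (- theta * (phi1 (kap n * (theta / y)) / k t)
     + PI * (phi (kap n * (theta / y)) * k1 t / k t ^ 2)) <= 20 * PI * exp (- t)).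
  { apply Rle_trans with (1 := Rabs_triang _ _).
    rewrite (Rabs_mult (- theta)), (Rabs_mult PI), Rabs_Ropp, (Rabs_right theta), (Rabs_right PI) by lra.
    assert (theta * Rabs (phi1 (kap n * (theta / y)) / k t) <= PI * (4 * exp (- t)))
      by (apply Rmult_le_compat; auto using Rabs_pos; lra).
    assert (PI * Rabs (phi (kap n * (theta / y)) * k1 t / k t ^ 2) <= PI * (16 * exp (- t)))
      by (apply Rmult_le_compat_l; lra).
    lra. }
  apply Rle_trans with (20 * PI * exp (- t) * 2).
  - apply Rmult_le_compat; auto using Rabs_pos.
  - assert (exp (- t) <= exp (- INR n)) by (apply exp_le; lra).
    replace (20 * PI * exp (- t) * 2) with (40 * PI * exp (- t)) by ring.
    apply Rmult_le_compat_l; lra.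
Qed.

Theorem derivative_identity :
  period_identity nu kap h g phi phi1 k k1 sigma theta dP.
Proof.
  pose proof PI_gt_3; pose proof radius_pos as Hr.
  assert (H1 : Rabs (1 - 1) < r) by (rewrite Rminus_diag, Rabs_R0; auto).
  pose proof (radius_spec 1 H1) as [Hb1 _].
  assert (ex_A : ex_series (fun n => image_deriv n 1)).
  { apply ex_series_dominated with (fun n => 16 * PI * exp (- INR n)).
    - intros n; now apply image_deriv_bound.
    - apply ex_series_exp_neg. }
  assert (HA : is_series (fun n => (-1) ^ S n * g (nu n * theta) / h (nu n * PI) ^ 2)
                 (/ PI * Series (fun n => image_deriv n 1))).
  { apply is_series_ext_R with (2 := is_series_scal_R (/ PI) _ _ (Series_correct _ ex_A)).
    intros n; unfold image_deriv; rewrite Rmult_1_r, <- Rmult_assoc, Rinv_l by lra; ring. }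
  assert (Ht : forall n, 1 <= PI * kap n /\ INR n <= PI * kap n).
  { intros n; specialize (Hkap n); pose proof (pos_INR n); split; nra. }
  assert (ex_B : ex_series (fun n => phi1 (kap n * theta) / k (PI * kap n))).
  { apply ex_series_dominated with (fun n => 4 * exp (- INR n)); [|apply ex_series_exp_neg].
    intros n; destruct (Ht n) as [Ht1 Ht2].
    destruct (exp_growing_inv k _ Gk Ht1) as [I1 I2].
    assert (exp (- (PI * kap n)) <= exp (- INR n)) by (apply exp_le; lra).
    unfold Rdiv; rewrite Rabs_mult, (Rabs_right (/ k _)) by lra.
    rewrite <- (Rmult_1_l (4 * exp (- INR n))).
    apply Rmult_le_compat; auto using Rabs_pos; lra. }
  assert (ex_D : ex_series (fun n => dual_deriv n 1)).
  { apply ex_series_dominated with (fun n => 40 * PI * exp (- INR n)).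
    - intros n; now apply dual_deriv_bound.
    - apply ex_series_exp_neg. }
  set (B := Series (fun n => phi1 (kap n * theta) / k (PI * kap n))).
  assert (HB : is_series (fun n => phi1 (kap n * theta) / k (PI * kap n)) B)
    by apply Series_correct, ex_B.
  (* At [beta = 1] the derivative of a dual term is [- theta] times the [B] term plus [PI] times the
     [C] term, so the sum of the [C] terms is solved for. *)
  assert (HC : is_series (fun n => phi (kap n * theta) * k1 (PI * kap n) / k (PI * kap n) ^ 2)
             (/ PI * (Series (fun n => dual_deriv n 1) + theta * B))).
  { pose proof (is_series_plus _ _ _ _ (Series_correct _ ex_D) (is_series_scal_R theta _ _ HB)) as H2.
    apply is_series_ext_R with (2 := is_series_scal_R (/ PI) _ _ H2).
    intros n; unfold dual_deriv; rewrite !Rdiv_1_r.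
    change plus with Rplus; rewrite pow1, Rdiv_1_r.
    match goal with |- / PI * (- theta * ?a + PI * ?b + theta * ?a) = _ =>
      transitivity (/ PI * PI * b); [ring|rewrite Rinv_l by lra; ring] end. }
  exists (/ PI * Series (fun n => image_deriv n 1)), B,
    (/ PI * (Series (fun n => dual_deriv n 1) + theta * B)).
  repeat split; auto.
  assert (DL : is_derive (fun b => Series (image_term h g nu b theta)) 1
                 (Series (fun n => image_deriv n 1))).
  { apply (is_derive_Series (fun n b => image_term h g nu b theta n) image_deriv
      (fun n => 16 * PI * exp (- INR n)) 1 r Hr).
    - exact is_derive_image_term.
    - exact image_deriv_bound.
    - apply ex_series_exp_neg.
    - intros y Hy; apply radius_spec in Hy.
      apply ex_series_dominated with (fun n => 8 * exp (- INR n)); [|apply ex_series_exp_neg].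
      intros n; destruct Hy as [[Hy1 Hy2] Hy3]; apply image_term_bound; auto; lra. }
  assert (DR : is_derive (fun b => Series (dual_term phi k kap theta b)) 1
                 (Series (fun n => dual_deriv n 1))).
  { apply (is_derive_Series (fun n b => dual_term phi k kap theta b n) dual_deriv
      (fun n => 40 * PI * exp (- INR n)) 1 r Hr).
    - exact is_derive_dual_term.
    - exact dual_deriv_bound.
    - apply ex_series_exp_neg.
    - intros y Hy; apply radius_spec in Hy; eexists; now apply Hbase. }
  assert (DR' : is_derive (fun b => P b - A0 - sigma * Series (image_term h g nu b theta)) 1
                  (dP - sigma * Series (fun n => image_deriv n 1))).
  { pose (L := fun b => Series (image_term h g nu b theta)).
    change (is_derive (fun b => P b - A0 - sigma * L b) 1 (dP - sigma * Series (fun n => image_deriv n 1))).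
    change (is_derive L 1 (Series (fun n => image_deriv n 1))) in DL.
    auto_derive.
    - repeat split; eexists; [apply HP|apply DL].
    - rewrite (is_derive_unique (fun y : R => P y) _ _ HP), (is_derive_unique (fun y : R => L y) _ _ DL); ring. }
  assert (DR2 : is_derive (fun b => Series (dual_term phi k kap theta b)) 1
                  (dP - sigma * Series (fun n => image_deriv n 1))).
  { refine (is_derive_ext_loc _ _ _ _ _ DR').
    exists (mkposreal r Hr); intros y Hy; symmetry; apply is_series_unique.
    change (Rabs (y - 1) < r) in Hy; apply radius_spec in Hy; now apply Hbase. }
  (* The dual series has now been differentiated twice, termwise and through the closed form given
     by [Hbase]; equating the results is the identity. *)
  apply is_derive_unique in DR; apply is_derive_unique in DR2.
  rewrite DR in DR2; rewrite DR2; field; lra.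
Qed.

End DerivativeAtOne.

(** * The four cases *)

Lemma is_RInt_linear_cos_half (k : R) :
  k <> 0 -> cos (k * PI) = 0 ->
  is_RInt (fun x => (PI - x) * cos (k * x)) 0 PI (/ k ^ 2).
Proof.
  intros Hk Hc.
  pose (F := fun x => (PI - x) * sin (k * x) / k - cos (k * x) / k ^ 2).
  replace (/ k ^ 2) with (F PI - F 0)
    by (unfold F; rewrite Hc, (Rmult_0_r k), sin_0, cos_0; field; auto).
  apply is_RInt_antiderivative.
  - intros x; unfold F; auto_derive; auto; field; auto.
  - intros x; apply (ex_derive_continuous (fun x => (PI - x) * cos (k * x))); auto_derive; auto.
Qed.

Lemma is_RInt_linear_sin_int (k : R) :
  k <> 0 -> sin (k * PI) = 0 ->
  is_RInt (fun x => (PI - x) / 2 * sin (k * x)) 0 PI (PI / 2 * / k).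
Proof.
  intros Hk Hs.
  pose (F := fun x => - (PI - x) / 2 * cos (k * x) / k - sin (k * x) / (2 * k ^ 2)).
  replace (PI / 2 * / k) with (F PI - F 0)
    by (unfold F; rewrite Hs, (Rmult_0_r k), sin_0, cos_0; field; auto).
  apply is_RInt_antiderivative.
  - intros x; unfold F; auto_derive; auto; field; auto.
  - intros x; apply (ex_derive_continuous (fun x => (PI - x) / 2 * sin (k * x))); auto_derive; auto.
Qed.

Definition nat_freq (n : nat) : R := INR (S n).
Definition half_freq (n : nat) : R := half_odd (S n).

Lemma nat_freq_ge (n : nat) : INR n + / 2 <= nat_freq n.
Proof. unfold nat_freq; rewrite S_INR; lra. Qed.

Lemma half_freq_ge (n : nat) : INR n + / 2 <= half_freq n.
Proof. unfold half_freq; rewrite half_odd_S; lra. Qed.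

Lemma nat_freq_incr (n : nat) : nat_freq n <= nat_freq (S n).
Proof. unfold nat_freq; rewrite (S_INR (S n)); lra. Qed.

Lemma half_freq_incr (n : nat) : half_freq n <= half_freq (S n).
Proof. unfold half_freq; rewrite !half_odd_S, S_INR; lra. Qed.

Lemma nat_freq_pos (n : nat) : 0 < nat_freq n.
Proof. apply lt_0_INR; lia. Qed.

Lemma half_freq_pos (n : nat) : 0 < half_freq n.
Proof. pose proof (half_odd_S_ge n); unfold half_freq; lra. Qed.

Lemma dual_of_expansion (phi k : R -> R) (kap nu : nat -> R) (theta beta sigma L Q : R) :
  0 < beta ->
  is_series (fun j => - / (kap j * k (PI * kap j / beta)) * phi (kap j * (theta / beta)))
    (alt_sum nu (beta * (theta / beta)) + sigma * L - Q) ->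
  is_series (dual_term phi k kap theta beta) (Q - alt_sum nu theta - sigma * L).
Proof.
  intros Hb H; replace (beta * (theta / beta)) with theta in H by (field; lra).
  replace (Q - alt_sum nu theta - sigma * L) with (-1 * (alt_sum nu theta + sigma * L - Q)) by ring.
  apply is_series_ext_R with (2 := is_series_scal_R (-1) _ _ H).
  intros n; unfold dual_term, Rdiv; ring.
Qed.

Lemma div_range (theta beta : R) :
  0 < beta -> 0 <= theta -> theta <= beta * PI -> 0 <= theta / beta <= PI.
Proof.
  intros Hb H0 H1; split.
  - apply Rmult_le_pos; auto; left; now apply Rinv_0_lt_compat.
  - apply Rmult_le_reg_r with beta; auto.
    unfold Rdiv; rewrite Rmult_assoc, Rinv_l; lra.
Qed.

(** The only case with a constant basis function. Its coefficient on the left comes from [eta_2] and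
    is matched by the term [PI / (12 * beta)], while [beta / PI * bern2] accounts for the terms
    [beta / (2 k^2)]. *)
Lemma base_cos_nat (theta beta : R) :
  3 / 4 < beta < 5 / 4 -> 0 <= theta -> theta <= beta * PI ->
  is_series (dual_term cos sinh nat_freq theta beta)
    (PI / (12 * beta) + beta / PI * bern2 (theta / beta) - alt_sum nat_freq theta
     - 1 * Series (image_term sinh cosh nat_freq beta theta)).
Proof.
  intros Hb Ht Htb; pose proof PI_gt_3.
  assert (Hb0 : 0 < beta) by lra.
  apply dual_of_expansion; auto.
  pose (c := fun k => - / (nat_freq k * sinh (PI * nat_freq k / beta))).
  apply (is_series_from1 c (fun k => cos (INR k * (theta / beta)))).
  replace (image_term sinh cosh nat_freq beta theta)
    with (image_term sinh cosh nat_freq beta (beta * (theta / beta)))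
    by (f_equal; field; lra).
  apply (base_identity (fun k x => cos (INR k * x)) cos_int_norm (from1 c)
    (fun k => match k with O => PI / (12 * beta) * PI + beta / PI * 0
                         | S _ => PI / (12 * beta) * 0 + beta / PI * (PI / 2 * / INR k ^ 2) end)
    nat_freq sinh cosh sinh (fun x => PI / (12 * beta) + beta / PI * bern2 x) 1 beta
    (fun n k => nat_freq n * beta / ((nat_freq n * beta) ^ 2 + INR k ^ 2)));
    auto using basis_cos_int, exp_growing_sinh, exp_bounded_cosh, is_derive_cosh,
      nat_freq_ge, nat_freq_incr, div_range; try lra.
  - intros x; apply (ex_derive_continuous (fun x => PI / (12 * beta) + beta / PI * bern2 x)).
    unfold bern2; auto_derive; auto.
  - intros n k; rewrite Rmult_1_l; apply kernel_cosh_sinh_cos.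
    + apply Rmult_lt_0_compat; [apply nat_freq_pos|lra].
    + apply cos_sin_INR_PI.
  - intros [|k].
    + apply is_RInt_eq_ext with (2 := is_RInt_lincomb _ _ _ _ (PI / (12 * beta)) (beta / PI)
        _ _ is_RInt_one is_RInt_bern2).
      intros x; simpl (INR 0); rewrite Rmult_0_l, cos_0; ring.
    + assert (Hk : INR (S k) <> 0) by (apply not_0_INR; lia).
      pose proof (proj2 (cos_sin_INR_PI (S k))) as Hs.
      apply is_RInt_eq_ext with (2 := is_RInt_lincomb _ _ _ _ (PI / (12 * beta)) (beta / PI)
        _ _ (is_RInt_one_cos _ Hk Hs) (is_RInt_bern2_cos _ Hk Hs)).
      intros x; ring.
  - intros [|k]; unfold cos_int_norm, from1.
    + replace (PI * 0 + (PI / (12 * beta) * PI + beta / PI * 0))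
        with (/ beta * (PI ^ 2 / 12)) by (field; lra).
      apply is_series_ext_R with (2 := is_series_scal_R (/ beta) _ _ eta_2).
      intros n; fold (nat_freq n); pose proof (nat_freq_pos n); simpl (INR 0); field; lra.
    + assert (Hk : 0 < INR (S k)) by apply nat_freq_pos.
      replace (PI / 2 * c k + (PI / (12 * beta) * 0 + beta / PI * (PI / 2 * / INR (S k) ^ 2)))
        with (PI / 2 * - / (INR (S k) * sinh (PI * INR (S k) / beta)) + beta / (2 * INR (S k) ^ 2)).
      * apply coefficient_sum_cos; lra.
      * unfold c, nat_freq; f_equal; field; lra.
  - apply ex_series_from1, dual_term_summable; auto using exp_growing_sinh, nat_freq_ge.
Qed.

(** At half-integer frequencies the coefficients [beta / (2 k^2)] belong to the linear function
    [beta / 2 * (PI - x)]. *)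
Lemma base_cos_half (theta beta : R) :
  3 / 4 < beta < 5 / 4 -> 0 <= theta -> theta <= beta * PI ->
  is_series (dual_term cos sinh half_freq theta beta)
    (beta / 2 * (PI - theta / beta) - alt_sum nat_freq theta
     - (-1) * Series (image_term cosh cosh nat_freq beta theta)).
Proof.
  intros Hb Ht Htb; pose proof PI_gt_3.
  assert (Hb0 : 0 < beta) by lra.
  apply dual_of_expansion; auto.
  replace (image_term cosh cosh nat_freq beta theta)
    with (image_term cosh cosh nat_freq beta (beta * (theta / beta)))
    by (f_equal; field; lra).
  apply (base_identity (fun k x => cos (half_freq k * x)) (fun _ => PI / 2)
    (fun k => - / (half_freq k * sinh (PI * half_freq k / beta)))
    (fun k => beta / (2 * half_freq k ^ 2))
    nat_freq cosh cosh sinh (fun x => beta / 2 * (PI - x)) (-1) beta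
    (fun n k => nat_freq n * beta / ((nat_freq n * beta) ^ 2 + half_freq k ^ 2)));
    auto using basis_cos_half, exp_growing_cosh, exp_bounded_cosh, is_derive_cosh,
      nat_freq_ge, nat_freq_incr, div_range; try lra.
  - intros x; apply (ex_derive_continuous (fun x => beta / 2 * (PI - x))); auto_derive; auto.
  - intros n k; replace (-1 * image_weight _ _) with (- image_weight cosh (nat_freq n * beta * PI)) by ring.
    apply kernel_sinh_cosh_cos.
    + apply Rmult_lt_0_compat; [apply nat_freq_pos|lra].
    + apply cos_sin_half_PI.
  - intros k; pose proof (half_freq_pos k).
    assert (Hk : half_freq k <> 0) by lra.
    pose proof (is_RInt_linear_cos_half _ Hk (proj1 (cos_sin_half_PI k))) as HI.
    replace (beta / (2 * half_freq k ^ 2)) with (beta / 2 * / half_freq k ^ 2 + 0 * / half_freq k ^ 2)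
      by (field; lra).
    apply is_RInt_eq_ext with (2 := is_RInt_lincomb _ _ _ _ (beta / 2) 0 _ _ HI HI).
    intros x; ring.
  - intros k; apply coefficient_sum_cos; [lra|apply half_freq_pos].
  - apply dual_term_summable; auto using exp_growing_sinh, half_freq_ge.
Qed.

(** Here the residual coefficients [PI / (2 k)] are those of the sawtooth [(PI - x) / 2]; at
    half-integer frequencies, in the next lemma, they are those of the constant [PI / 2]. *)
Lemma base_sin_nat (theta beta : R) :
  3 / 4 < beta < 5 / 4 -> 0 <= theta -> theta <= beta * PI ->
  is_series (dual_term sin cosh nat_freq theta beta)
    ((PI - theta / beta) / 2 - alt_sum half_freq theta
     - (-1) * Series (image_term sinh sinh half_freq beta theta)).
Proof.
  intros Hb Ht Htb; pose proof PI_gt_3.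
  assert (Hb0 : 0 < beta) by lra.
  apply dual_of_expansion; auto.
  replace (image_term sinh sinh half_freq beta theta)
    with (image_term sinh sinh half_freq beta (beta * (theta / beta)))
    by (f_equal; field; lra).
  apply (base_identity (fun k x => sin (nat_freq k * x)) (fun _ => PI / 2)
    (fun k => - / (nat_freq k * cosh (PI * nat_freq k / beta)))
    (fun k => PI / 2 * / nat_freq k)
    half_freq sinh sinh cosh (fun x => (PI - x) / 2) (-1) beta
    (fun n k => nat_freq k / ((half_freq n * beta) ^ 2 + nat_freq k ^ 2)));
    auto using basis_sin_int, exp_growing_sinh, exp_bounded_sinh, is_derive_sinh,
      half_freq_ge, half_freq_incr, div_range; try lra.
  - intros x; apply (ex_derive_continuous (fun x => (PI - x) / 2)); auto_derive; auto.
  - intros n k; replace (-1 * image_weight _ _) with (- image_weight sinh (half_freq n * beta * PI)) by ring.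
    apply kernel_sinh_sinh_sin.
    + apply Rmult_lt_0_compat; [apply half_freq_pos|lra].
    + apply cos_sin_INR_PI.
  - intros k; apply is_RInt_linear_sin_int; [apply Rgt_not_eq, nat_freq_pos|apply cos_sin_INR_PI].
  - intros k; apply coefficient_sum_sin; [lra|apply nat_freq_pos].
  - apply dual_term_summable; auto using exp_growing_cosh, nat_freq_ge.
Qed.

Lemma base_sin_half (theta beta : R) :
  3 / 4 < beta < 5 / 4 -> 0 <= theta -> theta <= beta * PI ->
  is_series (dual_term sin cosh half_freq theta beta)
    (PI / 2 - alt_sum half_freq theta
     - 1 * Series (image_term cosh sinh half_freq beta theta)).
Proof.
  intros Hb Ht Htb; pose proof PI_gt_3.
  assert (Hb0 : 0 < beta) by lra.
  apply dual_of_expansion; auto.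
  replace (image_term cosh sinh half_freq beta theta)
    with (image_term cosh sinh half_freq beta (beta * (theta / beta)))
    by (f_equal; field; lra).
  apply (base_identity (fun k x => sin (half_freq k * x)) (fun _ => PI / 2)
    (fun k => - / (half_freq k * cosh (PI * half_freq k / beta)))
    (fun k => PI / 2 * / half_freq k)
    half_freq cosh sinh cosh (fun x => PI / 2) 1 beta
    (fun n k => half_freq k / ((half_freq n * beta) ^ 2 + half_freq k ^ 2)));
    auto using basis_sin_half, exp_growing_cosh, exp_bounded_sinh, is_derive_sinh,
      half_freq_ge, half_freq_incr, div_range; try lra.
  - intros x; apply continuous_const.
  - intros n k; rewrite Rmult_1_l; apply kernel_cosh_cosh_sin.
    + apply Rmult_lt_0_compat; [apply half_freq_pos|lra].
    + apply cos_sin_half_PI.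
  - intros k; pose proof (half_freq_pos k).
    assert (Hk : half_freq k <> 0) by lra.
    exact (is_RInt_scal _ _ _ (PI / 2) _ (is_RInt_one_sin _ Hk (proj1 (cos_sin_half_PI k)))).
  - intros k; apply coefficient_sum_sin; [lra|apply half_freq_pos].
  - apply dual_term_summable; auto using exp_growing_cosh, half_freq_ge.
Qed.

Lemma is_derive_cos' (x : R) : is_derive cos x (- sin x).
Proof. auto_derive; auto; ring. Qed.

Lemma is_derive_sin' (x : R) : is_derive sin x (cos x).
Proof. auto_derive; auto; ring. Qed.

Lemma Rabs_opp_sin_le1 (x : R) : Rabs (- sin x) <= 1.
Proof. rewrite Rabs_Ropp; apply Rabs_sin_le1. Qed.

Lemma sinh_plus_cosh (x : R) : sinh x + cosh x = exp x.
Proof. rewrite Rplus_comm; apply cosh_plus_sinh. Qed.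

Lemma cosh_neg (x : R) : cosh (- x) = cosh x.
Proof. unfold cosh; rewrite Ropp_involutive; field. Qed.

Lemma sinh_neg (x : R) : sinh (- x) = - sinh x.
Proof. unfold sinh; rewrite Ropp_involutive; field. Qed.

Theorem theorem2p1 (theta : R) (htheta : Rabs theta < PI) :
  (exists A B C : R,
      sum_from_1 (fun n => (-1) ^ n * cosh (INR n * theta)
                           / sinh (PI * INR n) ^ 2) A /\
      sum_from_1 (fun n => sin (INR n * theta) / sinh (PI * INR n)) B /\
      sum_from_1 (fun n => cos (INR n * theta) * cosh (PI * INR n)
                           / sinh (PI * INR n) ^ 2) C /\
      PI ^ 2 * A + theta * PI * B + PI ^ 2 * C
        + theta ^ 2 / 4 - 1 / 2 * zeta 2 = 0) /\
  (exists A B C : R,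
      sum_from_1 (fun n => (-1) ^ n * sinh (half_odd n * theta)
                           / cosh (half_odd n * PI) ^ 2) A /\
      sum_from_1 (fun n => cos (half_odd n * theta)
                           / cosh (half_odd n * PI)) B /\
      sum_from_1 (fun n => sin (half_odd n * theta) * sinh (half_odd n * PI)
                           / cosh (half_odd n * PI) ^ 2) C /\
      PI ^ 2 * A - theta * PI * B + PI ^ 2 * C = 0) /\
  (exists A B C : R,
      sum_from_1 (fun n => (-1) ^ n * cosh (INR n * theta)
                           / cosh (PI * INR n) ^ 2) A /\
      sum_from_1 (fun n => sin (half_odd n * theta)
                           / sinh (half_odd n * PI)) B /\
      sum_from_1 (fun n => cos (half_odd n * theta) * cosh (half_odd n * PI)
                           / sinh (half_odd n * PI) ^ 2) C /\
      PI ^ 2 * A - theta * PI * B - PI ^ 2 * C + PI ^ 2 / 2 = 0) /\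
  (exists A B C : R,
      sum_from_1 (fun n => (-1) ^ n * sinh (half_odd n * theta)
                           / sinh (half_odd n * PI) ^ 2) A /\
      sum_from_1 (fun n => cos (INR n * theta) / cosh (PI * INR n)) B /\
      sum_from_1 (fun n => sin (INR n * theta) * sinh (PI * INR n)
                           / cosh (PI * INR n) ^ 2) C /\
      PI ^ 2 * A + theta * PI * B - PI ^ 2 * C + PI * theta / 2 = 0).
Proof.
  pose proof PI_gt_3.
  split; [|split; [|split]].
  - destruct (period_identity_parity nat_freq nat_freq sinh cosh cos (fun x => - sin x) sinh cosh
      (fun t => PI / 12 - t ^ 2 / (4 * PI)) 1 1) with theta
      as (A & B & C & HA & HB & HC & E); auto.
    { intros; rewrite cosh_neg; ring. }
    { intros; rewrite cos_neg; ring. }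
    { intros; rewrite sin_neg; ring. }
    { intros; field; lra. }
    { intros t Ht; apply derivative_identity with cosh
        (fun b => PI / (12 * b) + b / PI * bern2 (t / b)) (alt_sum nat_freq t);
        auto using nat_freq_ge, is_derive_sinh, sinh_plus_cosh, exp_growing_sinh, exp_bounded_cosh,
          is_derive_cos', Rabs_cos_le1, Rabs_opp_sin_le1.
      - intros; apply base_cos_nat; lra.
      - unfold bern2; auto_derive; [repeat split; lra|field; lra]. }
    exists A, (-1 * B), C; repeat split.
    + apply is_series_ext_R with (2 := HA); intros n; now rewrite (Rmult_comm _ PI).
    + apply is_series_ext_R with (2 := is_series_scal_R (-1) _ _ HB).
      intros n; unfold nat_freq, Rdiv; ring.
    + exact HC.
    (* The period identity multiplied by [PI]: [PI * (PI / 12)] is half of [zeta 2]. *)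
    + rewrite zeta_2; replace A with ((PI / 12 - theta ^ 2 / (4 * PI) + theta * B - PI * C) / PI)
        by (rewrite <- E; field; lra); field; lra.
  - destruct (period_identity_parity half_freq half_freq cosh sinh sin cos cosh sinh
      (fun _ => 0) 1 (-1)) with theta
      as (A & B & C & HA & HB & HC & E); auto.
    { intros; rewrite sinh_neg; ring. }
    { intros; rewrite sin_neg; ring. }
    { intros; rewrite cos_neg; ring. }
    { intros; ring. }
    { intros t Ht; apply derivative_identity with sinh (fun _ => PI / 2) (alt_sum half_freq t);
        auto using half_freq_ge, is_derive_cosh, cosh_plus_sinh, exp_growing_cosh, exp_bounded_sinh,
          is_derive_sin', Rabs_cos_le1, Rabs_sin_le1.
      - intros; apply base_sin_half; lra.
      - auto_derive; auto. }
    exists A, B, C; repeat split.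
    + exact HA.
    + apply is_series_ext_R with (2 := HB); intros n; now rewrite (Rmult_comm PI).
    + apply is_series_ext_R with (2 := HC); intros n; now rewrite (Rmult_comm PI).
    + transitivity (PI * (1 * PI * A - theta * B + PI * C)); [ring|rewrite E; ring].
  - destruct (period_identity_parity nat_freq half_freq cosh cosh cos (fun x => - sin x) sinh cosh
      (fun _ => PI / 2) (-1) 1) with theta
      as (A & B & C & HA & HB & HC & E); auto.
    { intros; rewrite cosh_neg; ring. }
    { intros; rewrite cos_neg; ring. }
    { intros; rewrite sin_neg; ring. }
    { intros; ring. }
    { intros t Ht; apply derivative_identity with sinh
        (fun b => b / 2 * (PI - t / b)) (alt_sum nat_freq t);
        auto using nat_freq_ge, half_freq_ge, is_derive_cosh, is_derive_sinh, cosh_plus_sinh,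
          exp_growing_cosh, exp_growing_sinh, exp_bounded_cosh,
          is_derive_cos', Rabs_cos_le1, Rabs_opp_sin_le1.
      - intros; apply base_cos_half; lra.
      - auto_derive; [repeat split; lra|field]. }
    exists A, (-1 * B), C; repeat split.
    + apply is_series_ext_R with (2 := HA); intros n; now rewrite (Rmult_comm _ PI).
    + apply is_series_ext_R with (2 := is_series_scal_R (-1) _ _ HB).
      intros n; rewrite (Rmult_comm PI); unfold half_freq, Rdiv; ring.
    + apply is_series_ext_R with (2 := HC); intros n; now rewrite (Rmult_comm PI).
    (* With [sigma = -1] the period identity is multiplied by [- PI], so that [A] regains the
       coefficient [PI ^ 2]. *)
    + transitivity (- PI * (-1 * PI * A - theta * B + PI * C) + PI ^ 2 / 2); [ring|rewrite E; field].
  - destruct (period_identity_parity half_freq nat_freq sinh sinh sin cos cosh sinh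
      (fun t => t / 2) (-1) (-1)) with theta
      as (A & B & C & HA & HB & HC & E); auto.
    { intros; rewrite sinh_neg; ring. }
    { intros; rewrite sin_neg; ring. }
    { intros; rewrite cos_neg; ring. }
    { intros; field. }
    { intros t Ht; apply derivative_identity with cosh
        (fun b => (PI - t / b) / 2) (alt_sum half_freq t);
        auto using nat_freq_ge, half_freq_ge, is_derive_cosh, is_derive_sinh, sinh_plus_cosh,
          exp_growing_cosh, exp_growing_sinh, exp_bounded_sinh,
          is_derive_sin', Rabs_cos_le1, Rabs_sin_le1.
      - intros; apply base_sin_nat; lra.
      - auto_derive; [repeat split; lra|field]. }
    exists A, B, C; repeat split; auto.
    transitivity (- PI * (-1 * PI * A - theta * B + PI * C) + PI * theta / 2); [ring|rewrite E; field].
Qed.
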